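(* Let $R$ be a unitary ring of finite cardinality $2^a m$, where $m$ is an odd number, and suppose that the group of units $R^*$ is a minimal non-nilpotent group. Then $|R|=2^a$. Moreover, if $(R/Jac(R))^*$ is not a $p$-group (for any prime $p$), then either $R\cong M_2(GF(2))$ or $R\cong M_2(GF(2))\oplus A$, where $A$ is a direct sum of copies of the finite field of order two.
   Context: Rings are associative, not necessarily commutative, with identity $1\neq 0$. $R^*$ denotes the group of units of $R$, $Jac(R)$ the Jacobson radical of $R$, $M_2(GF(2))$ the ring of $2\times 2$ matrices over the finite field $GF(2)$ with two elements. A group $G$ is a minimal non-nilpotent group if $G$ is not nilpotent but every proper subgroup of $G$ is nilpotent. *)

(* Defs.v *)
From HB Require Import structures.
From mathcomp Require Import all_boot all_fingroup all_algebra all_solvable.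
From mathcomp Require Import generic_quotient ring_quotient.

Set Implicit Arguments.
Unset Strict Implicit.
Unset Printing Implicit Defensive.

Import GRing.Theory.
Local Open Scope ring_scope.
Local Open Scope quotient_scope.

Definition min_nonnilpotent (gT : finGroupType) (G : {group gT}) : Prop :=
  ~~ nilpotent G /\ forall H : {group gT}, H \proper G -> nilpotent H.

Definition ring_isom (R S : pzRingType) : Prop :=
  exists f : {rmorphism R -> S}, bijective f.

Section Jacobson.
Variable R : finNzRingType.
Implicit Types M : {set R}.

Definition proper_left_ideal M : bool :=
  [&& 0 \in M, 1 \notin M &
      [forall a : R, forall u in M, forall v in M, a * u + v \in M]].

(* The library's [idealr_closed] is closure under *left* multiplication, so   *)
(* it describes proper left ideals.                                          *)
Lemma proper_left_idealP M :
  reflect (idealr_closed (mem M)) (proper_left_ideal M).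
Proof.
apply: (iffP and3P) => -[M0 M1 H]; split=> //.
- move=> a u v Mu Mv.
  by move/forallP/(_ a)/forall_inP/(_ u Mu)/forall_inP/(_ v Mv): H.
- apply/forallP=> a; apply/forall_inP=> u Mu; apply/forall_inP=> v Mv.
  exact: H.
Qed.

Definition maximal_left_ideal M : bool := maxset proper_left_ideal M.

Definition Jac : {pred R} :=
  [pred x | [forall M : {set R}, maximal_left_ideal M ==> (x \in M)]].

Lemma JacP x :
  reflect (forall M, maximal_left_ideal M -> x \in M) (x \in Jac).
Proof. exact: (iffP forall_inP). Qed.

Lemma Jac_idealr : idealr_closed Jac.
Proof.
split.
- apply/JacP=> M /maxsetp/proper_left_idealP[M0 _ _]; exact: M0.
- have I0 : proper_left_ideal [set 0].
    apply/proper_left_idealP; split; rewrite ?inE ?oner_eq0 //.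
    by move=> a u v; rewrite !inE => /eqP-> /eqP->; rewrite mulr0 addr0.
  have [M maxM _] := maxset_exists I0.
  apply/negP=> /JacP/(_ M maxM).
  by have /proper_left_idealP[_ /negPf /= M1 _] := maxsetp maxM; rewrite M1.
- move=> a u v /JacP Ju /JacP Jv; apply/JacP=> M maxM.
  have /proper_left_idealP[_ _ H] := maxsetp maxM.
  by apply: H; [apply: Ju | apply: Jv].
Qed.

HB.instance Definition _ := isIdealr.Build R Jac Jac_idealr.

(* Right stability: for [M] a maximal left ideal and [b \notin M], the left   *)
(* ideal [{y | y * b \in M}] is again maximal.                               *)
Lemma JacMl x b : x \in Jac -> x * b \in Jac.
Proof.
move=> /JacP Jx; apply/JacP=> M maxM.
have [MI Mmax] := maxsetP maxM.
have /proper_left_idealP[M0 M1 H] := MI.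
have MZ a u : u \in M -> a * u \in M.
  by move=> Mu; rewrite -[a * u]addr0; apply: H.
have MD u v : u \in M -> v \in M -> u + v \in M.
  by move=> Mu Mv; rewrite -[u]mul1r; apply: H.
have [Mb|nMb] := boolP (b \in M); first exact: MZ.
pose N := [set y : R | y * b \in M].
suff maxN : maximal_left_ideal N by have := Jx N maxN; rewrite inE.
apply/maxsetP; split.
  apply/proper_left_idealP; split; rewrite ?inE ?mul0r ?mul1r //.
  by move=> a u v; rewrite !inE => Nu Nv; rewrite mulrDl -mulrA; apply: H.
move=> L LI sNL; apply/eqP; rewrite eqEsubset sNL andbT.
have /proper_left_idealP[L0 /negP L1 HL] := LI.
have LD u v : u \in L -> v \in L -> u + v \in L.
  by move=> Lu Lv; rewrite -[u]mul1r; apply: HL.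
have LZ a u : u \in L -> a * u \in L.
  by move=> Lu; rewrite -[a * u]addr0; apply: HL.
apply/subsetP=> l Ll; rewrite inE; apply/negP=> nMlb; apply: L1.
pose K := [set z : R | [exists r, z - r * (l * b) \in M]].
have sMK : M \subset K.
  apply/subsetP=> z Mz; rewrite inE; apply/existsP; exists 0.
  by rewrite mul0r subr0.
have Klb : l * b \in K.
  by rewrite inE; apply/existsP; exists 1; rewrite mul1r subrr; exact: M0.
have KN : ~~ proper_left_ideal K.
  by apply/negP=> KI; move: nMlb; rewrite -(Mmax K KI sMK) => /(_ Klb).
have K1 : 1 \in K.
  apply/negPn/negP=> K1; case/negP: KN; apply/proper_left_idealP; split=> //.
    exact: (subsetP sMK).
  move=> a u v; rewrite !inE => /existsP[r Mr] /existsP[s Ms].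
  apply/existsP; exists (a * r + s); rewrite mulrDl opprD addrACA -mulrA.
  by rewrite -mulrBr; apply: H.
have [r Mr] : exists r, 1 - r * (l * b) \in M.
  by apply/existsP; move: K1; rewrite inE.
have Nbr : 1 - b * r * l \in N -> 1 \in L.
  move=> Ny; rewrite -(subrK (b * r * l) 1); apply: LD; last exact: LZ.
  exact: (subsetP sNL).
apply: Nbr; rewrite inE mulrBl mul1r.
have -> : b - b * r * l * b = b * (1 - r * (l * b)).
  by rewrite mulrBr mulr1 !mulrA.
exact: MZ.
Qed.

(* The ring structure of [{ideal_quot _}] in the library is limited to        *)
(* commutative rings; it is rebuilt here, [Jac] being two-sided.             *)
Definition Jac_quot : Type := {ideal_quot Jac}.

HB.instance Definition _ := Choice.on Jac_quot.
HB.instance Definition _ := GRing.Zmodule.on Jac_quot.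
HB.instance Definition _ : EqQuotient R (Quotient.equiv Jac) Jac_quot :=
  EqQuotient.on Jac_quot.
HB.instance Definition _ :=
  ZmodQuotient.on Jac_quot.
HB.instance Definition _ :=
  CanIsCountable (@reprK _ Jac_quot : cancel (repr : Jac_quot -> R) _).
HB.instance Definition _ : isFinite Jac_quot :=
  CanIsFinite (@reprK _ Jac_quot : cancel (repr : Jac_quot -> R) _).

Definition Jac_one : Jac_quot := \pi_Jac_quot 1.
Definition Jac_mul (x y : Jac_quot) : Jac_quot := \pi_Jac_quot (repr x * repr y).

Lemma Jac_pi_mul : {morph \pi_Jac_quot : x y / x * y >-> Jac_mul x y}.
Proof.
move=> x y; apply/eqP; rewrite -[_ == _](Quotient.idealrBE Jac).
set x' := repr _; set y' := repr _.
have Jx : x - x' \in Jac by rewrite (Quotient.idealrBE Jac) reprK.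
have Jy : y - y' \in Jac by rewrite (Quotient.idealrBE Jac) reprK.
have -> : x * y - x' * y' = x * (y - y') + (x - x') * y'.
  by rewrite mulrBr mulrBl addrA subrK.
by apply: rpredD; [apply: idealMr | apply: JacMl].
Qed.

Lemma Jac_mulA : associative Jac_mul.
Proof.
move=> x y z; rewrite -[x]reprK -[y]reprK -[z]reprK.
rewrite -(Jac_pi_mul (repr y)) -Jac_pi_mul.
by rewrite -(Jac_pi_mul (repr x) (repr y)) -Jac_pi_mul mulrA.
Qed.
Lemma Jac_mul1l : left_id Jac_one Jac_mul.
Proof. by move=> x; rewrite -[x]reprK -Jac_pi_mul mul1r. Qed.
Lemma Jac_mul1r : right_id Jac_one Jac_mul.
Proof. by move=> x; rewrite -[x]reprK -Jac_pi_mul mulr1. Qed.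
Lemma Jac_mulDl : left_distributive Jac_mul +%R.
Proof.
move=> x y z; rewrite -[x]reprK -[y]reprK -[z]reprK.
by rewrite -!Jac_pi_mul -!pi_addr -Jac_pi_mul mulrDl.
Qed.
Lemma Jac_mulDr : right_distributive Jac_mul +%R.
Proof.
move=> x y z; rewrite -[x]reprK -[y]reprK -[z]reprK.
by rewrite -!Jac_pi_mul -!pi_addr -Jac_pi_mul mulrDr.
Qed.
Lemma Jac_one_neq0 : Jac_one != 0.
Proof.
rewrite /Jac_one -[0](@pi_zeror _ _ _ _ _ Jac_quot) -[_ == _](Quotient.idealrBE Jac).
by rewrite subr0 idealr1.
Qed.

HB.instance Definition _ := GRing.Zmodule_isNzRing.Build Jac_quot
  Jac_mulA Jac_mul1l Jac_mul1r Jac_mulDl Jac_mulDr Jac_one_neq0.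
HB.instance Definition _ := @isNzRingQuotient.Build
  R (Quotient.equiv Jac) 0 -%R +%R 1 *%R Jac_quot (erefl _) Jac_pi_mul.
(* Despite its name, this factory is the one that supplies the units of a    *)
(* finite ring: [x] is a unit iff it has a two-sided inverse.                *)
HB.instance Definition _ := FinRing.isNzRing.Build Jac_quot.

End Jacobson.

Arguments Jac R : clear implicits.

(* Main.v *)
(* Let G be the unit group of R and J its Jacobson radical. Either R contains *)
(* elements a, b <> 0 generating 2 x 2 matrix units e = ab, a, b, f = ba, or  *)
(* R/J is reduced, hence commutative by Wedderburn's theorem.                 *)
(*   In the first case the two integer matrices of determinant +-1 that       *)
(* generate a copy of S_3 in GL_2(Z) give units of R; by minimality they      *)
(* generate G. Listing these six units shows that e + f is central, that      *)
(* eRe = {0, e}, that 2 = 0, and that (1 - e - f)R has no nontrivial unit,    *)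
(* hence is a Boolean ring, i.e. a power of F_2.                              *)
(*   In the second case, let p be a prime such that J is a p-group; then      *)
(* P = 1 + J is a normal p-subgroup of G with abelian p'-quotient (R/J)^*.    *)
(* An element g with <g>P <> G lies in C_G(P)P, since <g>P is nilpotent.      *)
(* As C_G(P)P <> G, some element of prime power order generates G modulo P,   *)
(* so (R/J)^* is a q-group. This excludes the second case when |R| is a power *)
(* of 2 and (R/J)^* is not a q-group. If an odd prime p divides |R|, let c be *)
(* the central idempotent cutting out the p-part of R: minimality forces all  *)
(* units to be trivial on (1 - c)R, the cyclic group (R/J)^* has even order,  *)
(* all squares of units lie in C_G(P)P, and 4y = (y + c)^2 - (y - c)^2 gives  *)
(* G = C_G(P)P, a contradiction.                                              *)

Require Import Defs.
From HB Require Import structures.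
From mathcomp Require Import all_boot all_fingroup all_algebra all_solvable.
From mathcomp Require Import generic_quotient ring_quotient finfield.

Set Implicit Arguments.
Unset Strict Implicit.
Unset Printing Implicit Defensive.

Import GRing.Theory.
Local Open Scope ring_scope.

(** Three devices translate between [R] and its unit group: a nilpotent [x] gives the unit [1 + x];
    a central idempotent splits the units, so that by minimality they are all trivial on one factor
    ([central_idem_units]); and units map onto those of $R/J$ with kernel $1 + J$. Nilpotents and
    idempotents come from [expr_idem_ex]. The dichotomy is [matrix_units_or_reduced]. Matrix units
    lead to [mx_char2] and [ring_isom_matrix_units]; the reduced case rests on [Jac_units_cyclic],
    and its odd primes are excluded by [odd_reduced_absurd]. *)

Lemma ring_isomI (R S : pzRingType) (F : R -> S) :
  (forall x y, F (x + y) = F x + F y) -> (forall x y, F (x * y) = F x * F y) ->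
  F 1 = 1 -> bijective F -> ring_isom R S.
Proof.
move=> FD FM F1 bijF.
have F0 : F 0 = 0 by apply: (addrI (F 0)); rewrite -FD !addr0.
have FB : zmod_morphism F.
  move=> x y; rewrite FD; congr (_ + _); apply/eqP.
  by rewrite -addr_eq0 -FD addNr F0.
pose addF := GRing.isZmodMorphism.Build R S F FB.
pose mulF := GRing.isMonoidMorphism.Build R S F (F1, FM).
pose F' : {rmorphism R -> S} := HB.pack F addF mulF.
by exists F'.
Qed.

(** * Finite rings and their Jacobson radical *)

Section FiniteRing.
Variable R : finUnitRingType.
Implicit Types x y z : R.

(** By pigeonhole the powers of [x] are eventually periodic. The exponent is positive, so a zero
    idempotent means that [x] is nilpotent. *)
Lemma expr_idem_ex x : exists n, x ^+ n.+1 * x ^+ n.+1 = x ^+ n.+1.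
Proof.
pose F (i : 'I_#|R|.+1) := x ^+ i.
have /injectivePn[i [j neq_ij Fij]] : ~~ injectiveb F.
  by apply/negP=> /injectiveP/leq_card; rewrite card_ord ltnn.
wlog lt_ij : i j neq_ij Fij / (i < j)%N.
  move=> IH; case: (ltngtP i j) => [|lt_ji|/val_inj eq_ij]; first exact: IH.
    by apply: (IH j i); rewrite // eq_sym.
  by rewrite eq_ij eqxx in neq_ij.
pose d := (j - i)%N.
have d_gt0 : (0 < d)%N by rewrite subn_gt0.
have xD k : (i <= k)%N -> x ^+ (k + d) = x ^+ k.
  move=> le_ik; rewrite -(subnK le_ik) -addnA exprD subnKC 1?ltnW //.
  by rewrite -[x ^+ j]Fij -exprD.
have xM k m : (i <= k)%N -> x ^+ (k + m * d) = x ^+ k.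
  move=> le_ik; elim: m => [|m IHm]; first by rewrite mul0n addn0.
  by rewrite mulSnr addnA xD ?IHm // (leq_trans le_ik) ?leq_addr.
(* The exponent [i.+1 * d] is a multiple of the period [d] and at least [i], so doubling it does not
   change the power. *)
exists (i.+1 * d).-1; rewrite prednK ?muln_gt0 // -exprD xM //.
by rewrite (leq_trans (leqnSn i)) // leq_pmulr.
Qed.

Lemma mulr1C x y : x * y = 1 -> y * x = 1.
Proof.
move=> xy1; have inj_y : injective ( *%R y).
  by move=> u v /(congr1 ( *%R x)); rewrite !mulrA xy1 !mul1r.
have [z yz1] : exists z, y * z = 1 by exists (invF inj_y 1); rewrite f_invF.
by have -> : x = z by rewrite -[x]mulr1 -yz1 mulrA xy1 mul1r.
Qed.

Lemma unitr_mul1 x y : x * y = 1 -> x \is a GRing.unit.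
Proof. by move=> xy1; apply/unitrP; exists y; rewrite (mulr1C xy1). Qed.

Lemma unitr_mul1r x y : x * y = 1 -> y \is a GRing.unit.
Proof. by move/mulr1C/unitr_mul1. Qed.

Lemma nil_unit1B x n : x ^+ n = 0 -> 1 - x \is a GRing.unit.
Proof.
move=> xn0; apply: (@unitr_mul1 _ (\sum_(i < n) x ^+ i)).
by rewrite -opprB mulNr -subrX1 xn0 sub0r opprK.
Qed.

Lemma nil_unit1D x n : x ^+ n = 0 -> 1 + x \is a GRing.unit.
Proof.
move=> xn0; rewrite -[x]opprK; apply: (@nil_unit1B _ n).
by rewrite exprNn xn0 mulr0.
Qed.

(** If $R(1 - x)$ were proper, a maximal left ideal above it would contain [x] and [1 - x], hence 1.
    So [1 - x] has a left inverse, which suffices in a finite ring. *)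
Lemma Jac_unit1B x : x \in Jac R -> 1 - x \is a GRing.unit.
Proof.
move=> Jx; pose I := [set y * (1 - x) | y : R].
have [I1|nI1] := boolP (1 \in I).
  by have /imsetP[y _ /esym/unitr_mul1r] := I1.
have : proper_left_ideal I.
  apply/proper_left_idealP; split=> //; first by apply/imsetP; exists 0;
    rewrite ?mul0r.
  move=> a _ _ /imsetP[y _ ->] /imsetP[z _ ->].
  by apply/imsetP; exists (a * y + z); rewrite ?mulrDl ?mulrA.
case/maxset_exists=> M maxM sIM.
have /proper_left_idealP[M0 M1 MD] := maxsetp maxM.
have Mx : x \in M by move/JacP: Jx; apply.
case/negP: M1; rewrite -[1](subrK x) -[1 - x]mul1r; apply: MD => //.
by apply: (subsetP sIM); apply/imsetP; exists 1; rewrite ?mul1r.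
Qed.

Lemma Jac_idem x : x \in Jac R -> x * x = x -> x = 0.
Proof.
move=> /Jac_unit1B Ux xx; apply: (mulrI Ux).
by rewrite mulr0 mulrBl mul1r xx subrr.
Qed.

Lemma Jac_nil x : x \in Jac R -> exists n, x ^+ n = 0.
Proof.
move=> Jx; have [n idem] := expr_idem_ex x; exists n.+1.
by apply: Jac_idem idem; rewrite exprSr; apply: idealMr.
Qed.

(** If a maximal left ideal [M] misses [x], then $1 = m + yx$ with [m] in [M], and $m = 1 - yx$ is a
    unit. *)
Lemma in_Jac x : (forall y, exists n, (y * x) ^+ n = 0) -> x \in Jac R.
Proof.
move=> nilx; apply/JacP=> M maxM; apply: contraT => nMx.
have [MI Mmax] := maxsetP maxM.
have /proper_left_idealP[M0 M1 MD] := MI.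
pose N := [set m + y * x | m in M, y in R].
have sMN : M \subset N.
  by apply/subsetP=> m Mm; apply/imset2P; exists m 0; rewrite ?mul0r ?addr0.
have NI : proper_left_ideal N.
  apply/proper_left_idealP; split; first exact: (subsetP sMN).
    apply: contra M1 => /imset2P[m y Mm _ Dm].
    have [n yx0] := nilx y; have Um := nil_unit1B yx0.
    rewrite {1}Dm addrK in Um.
    by rewrite -(mulVr Um) -[_ * m]addr0; apply: MD.
  move=> a _ _ /imset2P[m y Mm _ ->] /imset2P[m' y' Mm' _ ->].
  apply/imset2P; exists (a * m + m') (a * y + y') => //; first exact: MD.
  by rewrite mulrDr mulrDl mulrA addrACA.
case/negP: nMx; rewrite -(Mmax N NI sMN).
by apply/imset2P; exists 0 1; rewrite ?mul1r ?add0r.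
Qed.

Lemma Jac_pi_eq x y :
  (\pi_(Jac_quot R)%qT x == \pi_(Jac_quot R)%qT y) = (x - y \in Jac R).
Proof. by rewrite (Quotient.idealrBE (Jac R)). Qed.

Lemma Jac_pi_eq0 x : (\pi_(Jac_quot R)%qT x == 0) = (x \in Jac R).
Proof. by rewrite -[0](@pi_zeror _ _ _ _ _ (Jac_quot R)) Jac_pi_eq subr0. Qed.

End FiniteRing.

(** * Units modulo the radical *)

Section UnitsModJac.
Variable R : finUnitRingType.
Implicit Types x y : R.

Definition piJ x : Jac_quot R := \pi_(Jac_quot R)%qT x.

Lemma piJ_is_zmod_morphism : zmod_morphism piJ.
Proof. by move=> x y; rewrite /piJ rmorphB. Qed.
Lemma piJ_is_monoid_morphism : monoid_morphism piJ.
Proof. by split=> [|x y]; rewrite /piJ (rmorph1, rmorphM). Qed.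

HB.instance Definition _ :=
  GRing.isZmodMorphism.Build R (Jac_quot R) piJ piJ_is_zmod_morphism.
HB.instance Definition _ :=
  GRing.isMonoidMorphism.Build R (Jac_quot R) piJ piJ_is_monoid_morphism.

Lemma piJ_repr (z : Jac_quot R) : exists x, piJ x = z.
Proof. by exists (repr z); rewrite /piJ reprK. Qed.

Lemma piJ_eq0 x : (piJ x == 0) = (x \in Jac R).
Proof. exact: Jac_pi_eq0. Qed.

Lemma piJ_unit x : (piJ x \is a GRing.unit) = (x \is a GRing.unit).
Proof.
apply/idP/idP=> [Ux|Ux]; last exact: rmorph_unit.
have [y Dy] := piJ_repr (piJ x)^-1.
have Jxy : 1 - x * y \in Jac R.
  by rewrite -piJ_eq0 rmorphB rmorphM rmorph1 /= Dy mulrV ?subrr.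
have := Jac_unit1B Jxy; rewrite opprB addrC subrK => Uxy.
by apply: (@unitr_mul1 _ _ (y * (x * y)^-1)); rewrite mulrA mulrV.
Qed.

Definition unitJ (u : {unit R}) : {unit (Jac_quot R)} :=
  FinRing.unit (Jac_quot R) (rmorph_unit piJ (valP u)).

Lemma unitJ_morph : {in [set: {unit R}] &, {morph unitJ : u v / (u * v)%g}}.
Proof. by move=> u v _ _; apply: val_inj; rewrite /= rmorphM. Qed.
Canonical unitJ_morphism := Morphism unitJ_morph.

Lemma ker_unitJ u : (u \in 'ker unitJ)%g = (val u - 1 \in Jac R).
Proof.
rewrite -piJ_eq0 rmorphB rmorph1 subr_eq0 !inE /=.
by rewrite -(inj_eq val_inj) /=.
Qed.

Lemma im_unitJ : (unitJ @* setT)%g = setT.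
Proof.
apply/setP=> v; rewrite [RHS]inE; apply/morphimP.
have [x Dx] := piJ_repr (val v).
have Ux : x \is a GRing.unit by rewrite -piJ_unit Dx (valP v).
by exists (FinRing.unit R Ux); rewrite ?inE //; apply: val_inj.
Qed.

End UnitsModJac.

(** * Corner rings *)

(* The hypotheses on [e] are arguments of [corner_pred] and [corner], so that *)
(* the ring structure of [eR] can be inferred from its carrier.               *)

Section Corner.
Variables (R : finUnitRingType) (e : R).
Hypotheses (e_neq0 : e != 0) (ee : e * e = e).
Hypothesis (ce : forall x, e * x = x * e).

Definition corner_pred of e != 0 & e * e = e & (forall x, e * x = x * e) :
  {pred R} := [pred x | e * x == x].
Local Notation S := (corner_pred e_neq0 ee ce).

Lemma corner_zmod_closed : zmod_closed S.
Proof.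
split=> [|x y]; rewrite !inE ?mulr0 // => /eqP ex /eqP ey.
by rewrite mulrBr ex ey.
Qed.
HB.instance Definition _ := GRing.isZmodClosed.Build R S corner_zmod_closed.

Definition corner : Type := {x : R | x \in S}.
HB.instance Definition _ := SubFinite.on corner.
HB.instance Definition _ := [SubChoice_isSubZmodule of corner by <:].
Local Notation eR := corner.

Lemma corner_mul_subproof (x y : eR) : val x * val y \in S.
Proof. by rewrite inE mulrA (eqP (valP x)). Qed.
Definition corner_mul (x y : eR) : eR :=
  Sub (val x * val y) (corner_mul_subproof x y).
Lemma corner_one_subproof : e \in S. Proof. exact/eqP. Qed.
Definition corner_one : eR := Sub e corner_one_subproof.

Lemma corner_mulA : associative corner_mul.
Proof. by move=> x y z; apply: val_inj; rewrite /= mulrA. Qed.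
Lemma corner_mul1l : left_id corner_one corner_mul.
Proof. by move=> x; apply: val_inj; rewrite /= (eqP (valP x)). Qed.
Lemma corner_mul1r : right_id corner_one corner_mul.
Proof. by move=> x; apply: val_inj; rewrite /= -ce (eqP (valP x)). Qed.
Lemma corner_mulDl : left_distributive corner_mul +%R.
Proof. by move=> x y z; apply: val_inj; rewrite /= mulrDl. Qed.
Lemma corner_mulDr : right_distributive corner_mul +%R.
Proof. by move=> x y z; apply: val_inj; rewrite /= mulrDr. Qed.
Lemma corner_one_neq0 : corner_one != 0.
Proof. by rewrite -(inj_eq val_inj). Qed.

HB.instance Definition _ := GRing.Zmodule_isNzRing.Build eR
  corner_mulA corner_mul1l corner_mul1r corner_mulDl corner_mulDr
    corner_one_neq0.
HB.instance Definition _ := FinRing.isNzRing.Build eR.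

Lemma corner_domain_comm :
  (forall x y : R, e * x = x -> e * y = y -> x * y = 0 -> x = 0 \/ y = 0) ->
  forall x y : R, e * x = x -> e * y = y -> x * y = y * x.
Proof.
move=> domR x y /eqP ex /eqP ey.
have domeR : forall u v : eR, u * v = 0 -> (u == 0) || (v == 0).
  move=> u v /(congr1 val)/= /domR[||u0|v0].
  - exact/eqP/(valP u).
  - exact/eqP/(valP v).
  - by rewrite -(inj_eq val_inj) /= u0 eqxx.
  - by rewrite -[v == 0](inj_eq val_inj) /= v0 eqxx orbT.
have := finDomain_mulrC domeR (exist _ x ex : corner) (exist _ y ey : corner).
by move/(congr1 val).
Qed.
End Corner.

(** The atom is an idempotent with the fewest elements of [B] below it. The lemma serves both
    reduced rings and the Boolean complement of the matrix units. *)
Lemma idem_atom_ex (R : finUnitRingType) (B : {pred R}) (e0 : R) :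
  {in B &, forall x y, x * y \in B} -> {in B, forall x, x * x = x} ->
  {in B &, forall x y, x * y = y * x} -> e0 \in B -> e0 != 0 ->
  exists e, [/\ e \in B, e != 0, e0 * e = e &
    {in B, forall g, e * g = 0 \/ e * g = e}].
Proof.
move=> BM Bid BC Be0 e0_neq0.
pose below e := [set x in B | e * x == x].
pose P e := [&& e \in B, e != 0 & e0 * e == e].
have P0 : P e0 by rewrite /P Be0 e0_neq0 Bid ?eqxx.
case: (arg_minnP (fun e => #|below e|) P0) => e 
  /and3P[Be e_neq0 /eqP e0e] min_e.
exists e; split=> // g Bg; have [->|eg_neq0] := eqVneq (e * g) 0; first by left.
right; have Beg : e * g \in B by apply: BM.
have sub_eg : below (e * g) \subset below e.
  apply/subsetP=> x; rewrite !inE => /andP[-> /eqP egx] /=.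
  by rewrite -egx !mulrA Bid.
have : below (e * g) == below e.
  by rewrite eqEcard sub_eg min_e // /P Beg eg_neq0 mulrA e0e eqxx.
move/eqP/setP/(_ e); rewrite !inE Be Bid // eqxx => /eqP ege.
by rewrite -[RHS]ege -mulrA (BC g) // mulrA Bid.
Qed.

(** * Finite reduced rings are commutative *)

Section Reduced.
Variable R : finUnitRingType.
Hypothesis reducedR : forall x : R, x * x = 0 -> x = 0.
Implicit Types x y e : R.

Lemma reduced_expr x n : x ^+ n.+1 = 0 -> x = 0.
Proof.
elim: n => [|n IHn] xn0; first by rewrite -[x]expr1.
by apply: IHn; apply: reducedR; rewrite -exprD -addSnnS exprD xn0 mul0r.
Qed.

Lemma reduced_idem_central e x : e * e = e -> e * x = x * e.
Proof.
move=> ee; have e'e : (1 - e) * e = 0 by rewrite mulrBl mul1r ee subrr.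
have ee' : e * (1 - e) = 0 by rewrite mulrBr mulr1 ee subrr.
have /eqP : e * x * (1 - e) = 0.
  by apply: reducedR; rewrite !mulrA -(mulrA _ (1 - e)) e'e mulr0 !mul0r.
have /eqP : (1 - e) * x * e = 0.
  by apply: reducedR; rewrite !mulrA -(mulrA _ e (1 - e)) ee' mulr0 !mul0r.
by rewrite mulrBl mul1r mulrBl mulrBr mulr1 !subr_eq0 => /eqP-> /eqP.
Qed.

(** Below the idempotent power of a non-nilpotent commutator [z] lies an atom [e]. Idempotent powers
    in $eR$ are 0 or [e], so $eR$ is a finite domain, commutative by Wedderburn. Hence $ze = 0$,
    although [e] lies below a power of [z]. *)
Lemma reduced_comm x y : x * y = y * x.
Proof.
apply/eqP; rewrite -subr_eq0; set z := x * y - y * x.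
have [n idem] := expr_idem_ex z; have [zn0|zn_neq0] := eqVneq (z ^+ n.+1) 0.
  by rewrite (reduced_expr zn0).
pose B : {pred R} := [pred e | e * e == e].
have BP e : reflect (e * e = e) (e \in B) by apply: eqP.
have [] := @idem_atom_ex R B (z ^+ n.+1).
- move=> e g /BP ee /BP gg; apply/BP.
  by rewrite mulrA -(mulrA e) (reduced_idem_central e gg) mulrA ee -mulrA gg.
- by move=> e /BP.
- by move=> e g /BP ee _; apply: reduced_idem_central.
- exact/BP.
- by [].
move=> e [/BP ee e_neq0 zne min_e].
have ce u := reduced_idem_central u ee.
have dome u v : e * u = u -> e * v = v -> u * v = 0 -> u = 0 \/ v = 0.
  move=> eu ev uv0; have [m] := expr_idem_ex u.
  move/BP/min_e; have -> : e * u ^+ m.+1 = u ^+ m.+1 by rewrite exprS mulrA eu.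
  case=> [/reduced_expr|um]; first by left.
  by right; rewrite -ev -um exprSr -mulrA uv0 mulr0.
have exy := corner_domain_comm e_neq0 ee ce dome.
have eM u v : e * (u * v) = (e * u) * (e * v).
  by rewrite !mulrA -(mulrA e u e) -(ce u) !mulrA ee.
have ez : z * e = 0.
  apply/eqP; rewrite -ce mulrBr !eM subr_eq0.
  by apply/eqP/exy; rewrite mulrA ee.
by case/eqP: e_neq0; rewrite -zne exprSr -mulrA ez mulr0.
Qed.
End Reduced.

(** * Minimal non-nilpotent groups *)

Section MinimalNonNilpotent.
Local Open Scope group_scope.
Variables (gT : finGroupType) (G : {group gT}).
Hypothesis mnnG : min_nonnilpotent G.

(* Otherwise [A] and [B] lie in the Fitting subgroup. *)
Lemma mnn_normal_mul (A B : {group gT}) :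
  A <| G -> B <| G -> A * B = G -> A :=: G \/ B :=: G.
Proof.
have [nnilG nilG] := mnnG => nsAG nsBG defG.
have [->|neqA] := eqVneq (A : {set gT}) G; first by left.
have [->|neqB] := eqVneq (B : {set gT}) G; first by right.
have sF (H : {group gT}) : H <| G -> H != G :> {set gT} -> H \subset 'F(G).
  by move=> nsHG neqH; rewrite Fitting_max // nilG // properEneq neqH
    normal_sub.
case/negP: nnilG; apply: nilpotentS (Fitting_nil G).
by rewrite -{1}defG mul_subG ?sF.
Qed.

Variables (rT : finGroupType) (f : {morphism G >-> rT}) (p : nat).
Hypotheses (pK : p.-group ('ker f)) (p'fG : p^'.-group (f @* G)).
Hypothesis (abfG : abelian (f @* G)).

(** Otherwise [mnn_normal_mul] makes one factor equal to [G]. The kernel is a p-group, hence not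
    [G]; and a central kernel with abelian quotient makes [G] nilpotent. *)
Lemma mnn_cent_ker : 'C_G('ker f) * 'ker f != G.
Proof.
have [nnilG _] := mnnG; apply/eqP=> defG.
have nsKG : 'ker f <| G := ker_normal f.
have nsCG : 'C_G('ker f) <| G.
  by have := subcent_normal G ('ker f); rewrite (setIidPl (normal_norm nsKG)).
have [defC|defK] := mnn_normal_mul nsCG nsKG defG; last first.
  by case/negP: nnilG; rewrite -defK (pgroup_nil pK).
case/negP: nnilG; rewrite -quotient_center_nil abelian_nil //.
rewrite sub_der1_abelian //.
have sKZ : 'ker f \subset 'Z(G).
  by rewrite subsetI normal_sub // centsC -{1}defC subsetIr.
apply: subset_trans sKZ; rewrite ker_trivg_morphim der_sub /=.
by rewrite morphim_der // (derG1P abfG).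
Qed.

(** In a nilpotent group the p'-part of [g] centralizes the p-group ['ker f], while the p-part of
    [g] dies in the p'-group [f @* G]. *)
Lemma mnn_mem_cent_ker g :
  g \in G -> <[g]> <*> 'ker f != G -> g \in 'C_G('ker f) * 'ker f.
Proof.
have [_ nilG] := mnnG => Gg neqH; set H := (<[g]> <*> 'ker f)%G.
have sHG : H \subset G by rewrite join_subG cycle_subG Gg
  normal_sub ?ker_normal.
have nilH : nilpotent H by rewrite nilG // properEneq neqH.
have Ggc pi : g.`_pi \in G by rewrite groupX.
rewrite -[g](consttC p^') consttNK; apply: mem_mulg; last first.
  apply/kerP; rewrite // morph_constt //; apply/constt1P.
  exact: mem_p_elt p'fG (mem_morphim f Gg Gg).
rewrite inE Ggc -cycle_subG.
have sub_nil := sub_nilpotent_cent2 nilH.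
apply: sub_nil; rewrite ?joing_subr //.
  by rewrite cycle_subG (subsetP (joing_subl _ _)) ?cycle_constt.
rewrite (pnat_coprime pK) // -orderE; exact: p_elt_constt.
Qed.

Lemma mnn_cyclic_mod :
  exists q g, [/\ prime q, g \in G, q.-elt g & <[g]> <*> 'ker f = G].
Proof.
have nsKG : 'ker f <| G := ker_normal f.
have X_G : group_set ('C_G('ker f) * 'ker f).
  apply/comm_group_setP/normC;
  by rewrite (subset_trans _ (normal_norm nsKG)) ?subsetIl.
pose X := Group X_G.
have [sGX|] := boolP (G \subset X).
  case/eqP: mnn_cent_ker; apply/eqP; rewrite eqEsubset sGX andbT.
  by rewrite mul_subG ?subsetIl ?normal_sub.
case/subsetPn=> g Gg nXg.
have [/forallP Xq|] := boolP [forall i : 'I_#[g].+1, g.`_i \in X].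
  case/negP: nXg; rewrite -(prod_constt g) big_mkord.
  by apply: group_prod => i _; apply: Xq.
rewrite negb_forall => /existsP[[q _] /= nXq].
(* The index [q] runs over all numbers up to [#[g]]; the constituent at a non-prime is 1. *)
have pr_q : prime q.
  apply: contraR nXq => npr_q; rewrite (constt1P _) ?(group1 X) //.
  apply/(pnatP _ (order_gt0 g))=> r pr_r _; rewrite !inE.
  by apply: contraNneq npr_q => <-.
exists q, g.`_q; split=> //; first by rewrite groupX.
  exact: p_elt_constt.
by apply/eqP; apply: contraR nXq; apply: mnn_mem_cent_ker; rewrite groupX.
Qed.

End MinimalNonNilpotent.

(** * Central idempotents and the units trivial on them *)

Section CentralIdempotent.
Variable R : finUnitRingType.
Implicit Types c d x : R.

Lemma mulr_unit_group_set d : group_set [set u : {unit R} | val u * d == d].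
Proof.
apply/group_setP; split=> [|u v]; rewrite !inE /= ?mul1r //.
by move=> /eqP ud /eqP vd; rewrite -mulrA vd ud.
Qed.
Canonical mulr_unit_group d := Group (mulr_unit_group_set d).

Lemma mulr_unit_group_normal d : (forall x, d * x = x * d) ->
  (mulr_unit_group d <| [set: {unit R}])%g.
Proof.
move=> cd; rewrite /normal subsetT; apply/subsetP=> v _; rewrite inE.
apply/subsetP=> _ /imsetP[u ud ->]; move: ud; rewrite !inE /= => /eqP ud.
by rewrite mulrA -!mulrA -cd !mulrA -(mulrA _ _ d) ud -!mulrA cd mulrA
  mulVr ?mul1r ?(valP v).
Qed.

(** A unit [u] is $uc + (1 - c)$ times a unit trivial on [c], so the unit group is a product of two
    normal subgroups and [mnn_normal_mul] applies. *)
Lemma central_idem_units c :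
  min_nonnilpotent [set: {unit R}]%G -> c * c = c ->
  (forall x, c * x = x * c) ->
  (forall u : {unit R}, val u * c = c) \/
  (forall u : {unit R}, val u * (1 - c) = 1 - c).
Proof.
move=> mnnR cc centc; have [d Dd] : exists d, d = 1 - c by exists (1 - c).
rewrite -Dd.
have cd : c * d = 0 by rewrite Dd mulrBr mulr1 cc subrr.
have dc : d * c = 0 by rewrite -centc cd.
have dd : d * d = d by rewrite {1}Dd mulrBl mul1r cd subr0.
have centd x : d * x = x * d by rewrite Dd mulrBl mulrBr mul1r mulr1 centc.
have splitM x y : (x * c + d) * (y * c + d) = x * y * c + d.
  rewrite mulrDl !mulrDr dd -!mulrA cd mulr0 addr0 [d * _]centd -mulrA cd
    mulr0 add0r.
  by rewrite [c * _]centc -mulrA cc.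
have UP (u : {unit R}) : val u * c + d \is a GRing.unit.
  apply: (@unitr_mul1 _ _ ((val u)^-1 * c + d)).
  by rewrite splitM mulrV ?(valP u) // mul1r Dd addrC subrK.
have fixE e : (mulr_unit_group e : {set {unit R}}) = [set: {unit R}] ->
    forall u : {unit R}, val u * e = e.
  by move/setP=> eqG u; have := eqG u; rewrite !inE => /eqP.
have [||||] := mnn_normal_mul mnnR (A := mulr_unit_group d)
                                     (B := mulr_unit_group c).
- exact: mulr_unit_group_normal.
- exact: mulr_unit_group_normal.
- apply/setP=> u; rewrite inE; apply/mulsgP.
  pose v := FinRing.unit R (UP u).
  exists v (v^-1 * u)%g; rewrite ?mulKVg // inE /=.
    by rewrite mulrDl dd -mulrA cd mulr0 add0r.
  have Uv := valP v; apply/eqP; apply: (mulrI Uv);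
    rewrite /= !mulrA divrr // mul1r.
  by rewrite mulrDl -mulrA cc dc addr0.
- by move/fixE; right.
- by move/fixE; left.
Qed.

Lemma natr_card x : x *+ #|R| = 0.
Proof. by have := expg_cardG (in_setT x); rewrite FinRing.zmodXgE cardsT. Qed.

Lemma prime_torsion p : prime p -> (p %| #|R|)%N ->
  exists2 x : R, x != 0 & x *+ p = 0.
Proof.
move=> pr_p; rewrite -cardsT => /(Cauchy pr_p)[x _ ox].
exists x; last by rewrite -FinRing.zmodXgE -ox expg_order.
by apply: contraTneq (prime_gt1 pr_p) => x0; rewrite -ox x0 order1.
Qed.

Lemma primary_idem p : prime p -> (p %| #|R|)%N ->
  exists c k, [/\ c * c = c, c != 0, forall x, c * x = x * c
    & c *+ (p ^ k) = 0].
Proof.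
move=> pr_p p_dv; pose q := (#|R|`_p)%N; pose r := (#|R|`_p^')%N.
have R_gt0 : (0 < #|R|)%N by apply/card_gt0P; exists 0.
have qr : (q * r)%N = #|R| := partnC p R_gt0.
have co_qr : coprime q r by rewrite /coprime; apply: coprime_partC.
have p_dv_q : (p %| q)%N.
  by rewrite /q p_part dvdn_exp // logn_gt0 mem_primes pr_p R_gt0.
have q_gt1 : (1 < q)%N.
  by apply: leq_trans (prime_gt1 pr_p) _; apply: dvdn_leq p_dv_q; apply:
    part_gt0.
have Dq : q = (p ^ logn p #|R|)%N by rewrite /q p_part.
clearbody q r.
(* With [n] congruent to 1 modulo [q] and to 0 modulo [r], both $n(n - 1)$ and $qn$ are multiples of
   $|R| = qr$. *)
have [n n1 r_dv_n] : exists2 n, (n %% q = 1)%N & (r %| n)%N.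
  exists (chinese q r 1 0); first by rewrite (chinese_modl co_qr) modn_small.
  by rewrite /dvdn (chinese_modr co_qr) mod0n.
have n_gt0 : (0 < n)%N by rewrite lt0n; apply: contra_eqN n1 => /eqP->;
  rewrite mod0n.
have q_dv_n1 : (q %| n.-1)%N.
  by rewrite -subn1 -eqn_mod_dvd // n1 modn_small.
have natr0 m : (#|R| %| m)%N -> m%:R = 0 :> R.
  by case/dvdnP=> l ->; rewrite mulrnA natr_card.
exists n%:R, (logn p #|R|); split.
- apply/eqP; rewrite -natrM -subr_eq0 -[in X in _ - X](mul1n n)
  -natrB ?leq_mul // -mulnBl.
  by apply/eqP/natr0; rewrite subn1 -qr dvdn_mul.
- have [x x_neq0 px0] := prime_torsion pr_p p_dv.
  apply: contraNneq x_neq0 => n0.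
  have [l Dl] := dvdnP (dvdn_trans p_dv_q q_dv_n1).
  have : x *+ n = 0 by rewrite -mulr_natr n0 mulr0.
  by rewrite -(prednK n_gt0) Dl mulrSr mulnC mulrnA px0 mul0rn add0r => ->.
- by move=> x; rewrite mulr_natl mulr_natr.
- rewrite -Dq -mulrnA natr0 // -qr mulnC dvdn_mul //.
Qed.

End CentralIdempotent.

(* With [e = a * b], the elements [e], [a], [b] and [b * a] are 2 x 2 matrix  *)
(* units.                                                                    *)
Definition matrix_unit_pair (R : finUnitRingType) (a b : R) : bool :=
  [&& a != 0, a * a == 0, b * b == 0, a * b * a == a & b * a * b == b].

(** Let $x^2 \in J$ and let $e = zx$ be a nonzero idempotent power of some $yx$. With $d = 1 - e$
    one finds $(ezd)(dxe) = e - j$ with $j \in J$; correcting by $(1 - j)^{-1}$ makes the product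
    [e], and the two factors are matrix units. *)
Lemma matrix_units_or_reduced (R : finUnitRingType) :
  (exists a b : R, matrix_unit_pair a b) \/
  (forall x : R, x * x \in Jac R -> x \in Jac R).
Proof.
have [/existsP[a /existsP[b ab]]|no_mx] :=
  boolP [exists a : R, [exists b : R, matrix_unit_pair a b]].
  by left; exists a, b.
right=> x Jxx; apply: in_Jac => y; have [n ee] := expr_idem_ex (y * x).
exists n.+1; move: ee; set e := _ ^+ _ => ee.
have [//|e_neq0] := eqVneq e 0; case/negP: no_mx.
have [z Dz] : exists z, e = z * x by exists ((y * x) ^+ n * y);
  rewrite -mulrA -exprSr.
clearbody e; have [d Dd] : exists d, d = 1 - e by exists (1 - e).
have ed : e * d = 0 by rewrite Dd mulrBr mulr1 ee subrr.
have de : d * e = 0 by rewrite Dd mulrBl mul1r ee subrr.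
have dd : d * d = d by rewrite {1}Dd mulrBl mul1r ed subr0.
pose v := d * x * e; pose j := e * z * (e * x * e).
(* Here [e * x * e] equals [z * (x * x) * e]. *)
have Jj : j \in Jac R.
  by apply: idealMr; rewrite {1}Dz; apply: JacMl; rewrite -mulrA; apply:
    idealMr.
have Uj := Jac_unit1B Jj; pose u := (1 - j)^-1.
have uj : u * (1 - j) = 1 by rewrite mulVr.
have ej : e * j = j by rewrite /j !mulrA ee.
have je : j * e = j by rewrite /j -!mulrA ee.
have ue : u * e = e * u.
  apply: (mulrI Uj); rewrite mulrA mulrV // mul1r mulrA.
  have -> : (1 - j) * e = e * (1 - j) by rewrite mulrBl mulrBr mul1r mulr1 ej
    je.
  by rewrite -mulrA mulrV // mulr1.
pose w := u * e * z * d.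
have wv : w * v = e.
  have -> : w * v = u * (e * z * d * x * e).
    by rewrite /w /v !mulrA -(mulrA _ d d) dd.
  have -> : e * z * d * x * e = (1 - j) * e.
    rewrite Dd mulrBr mulr1 !mulrBl mul1r je /j; congr (_ - _);
      last by rewrite !mulrA.
    by rewrite -(mulrA e z x) -Dz !ee.
  by rewrite mulrA uj mul1r.
have we : w * e = 0 by rewrite /w -mulrA de mulr0.
have ew : e * w = w by rewrite /w !mulrA -ue -(mulrA u e e) ee.
have ev : e * v = 0 by rewrite /v !mulrA ed !mul0r.
have ve : v * e = v by rewrite /v -mulrA ee.
apply/existsP; exists w; apply/existsP; exists v.
apply/and5P; split; apply/eqP.
- by move=> w0; case/eqP: e_neq0; rewrite -wv w0 mul0r.
- by rewrite -[X in _ * X]ew mulrA we mul0r.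
- by rewrite -[X in X * _]ve -mulrA ev mulr0.
- by rewrite wv ew.
- by rewrite -mulrA wv ve.
Qed.

(** * Rings with 2 x 2 matrix units *)

Section MatrixUnits.
Variables (R : finUnitRingType) (a b : R).
Hypothesis ab_mx : matrix_unit_pair a b.
Local Notation e := (a * b).
Local Notation f := (b * a).

(* Locked, because rewriting with distributivity would otherwise expand it. *)
Definition mx_compl : R := locked (1 - (e + f)).
Local Notation h := mx_compl.

Lemma mx_complE : h = 1 - (e + f). Proof. exact/esym/lock. Qed.

Let aa : a * a = 0. Proof. by case/and5P: ab_mx => _ /eqP. Qed.
Let bb : b * b = 0. Proof. by case/and5P: ab_mx => _ _ /eqP. Qed.
Let ea : a * b * a = a. Proof. by case/and5P: ab_mx => _ _ _ /eqP. Qed.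
Let fb : b * a * b = b. Proof. by case/and5P: ab_mx => _ _ _ _ /eqP. Qed.
Let ha : h * a = 0.
Proof. by rewrite mx_complE mulrBl mul1r mulrDl ea -mulrA aa mulr0 addr0
  subrr. Qed.
Let hb : h * b = 0.
Proof. by rewrite mx_complE mulrBl mul1r mulrDl fb -mulrA bb mulr0 add0r
  subrr. Qed.
Let ah : a * h = 0.
Proof. by rewrite mx_complE mulrBr mulr1 mulrDr !mulrA aa mul0r add0r ea
  subrr. Qed.
Let bh : b * h = 0.
Proof. by rewrite mx_complE mulrBr mulr1 mulrDr !mulrA bb mul0r addr0 fb
  subrr. Qed.
Let hh : h * h = h.
Proof. by rewrite {2}mx_complE mulrBr mulr1 mulrDr !mulrA ha hb !mul0r addr0
  subr0. Qed.

(* The integer matrix [[p, q], [r, s]] in the corner (e + f)R(e + f), *)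
(* completed by the identity.                                         *)
Definition mx_block (p q r s : int) : R :=
  h + (e *~ p + a *~ q) + (b *~ r + f *~ s).

Lemma mx_blockM p q r s p' q' r' s' :
  mx_block p q r s * mx_block p' q' r' s' =
  mx_block (p * p' + q * r') (p * q' + q * s') (r * p' + s * r')
    (r * q' + s * s').
Proof.
rewrite /mx_block; move: h ha hb ah bh hh => g ga gb ag bg gg.
rewrite !(mulrDl, mulrDr) !(mulrzAl, mulrzAr) !mulrA.
rewrite ?(ea, fb, ga, gb, ag, bg, aa, bb, gg) -?(mulrA _ a a) -?(mulrA _ b b).
rewrite -?(mulrA _ _ g).
rewrite ?(ga, gb, ag, bg, aa, bb, mulr0, mul0r, mul0rz, add0r, addr0).
rewrite !mulrzDr !mulrzA.
congr (g + _ + _); rewrite addrACA.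
  by congr (_ + _ + (_ + _)); rewrite -!mulrzA mulrC.
by congr (_ + _ + (_ + _)); rewrite -!mulrzA mulrC.
Qed.

Lemma mx_block1 : mx_block 1 0 0 1 = 1.
Proof. by rewrite /mx_block !mulr1z !mulr0z addr0 add0r mx_complE -addrA
  subrK. Qed.

Let e_neq0 : e != 0.
Proof. by case/and5P: ab_mx => + _ _ _ _; apply: contra_neq => e0;
  rewrite -ea e0 mul0r. Qed.
Let b_neq0 : b != 0.
Proof. by apply: contra_neq e_neq0 => ->; rewrite mulr0. Qed.

Let mx_block_row2 p q r s : f * mx_block p q r s = b *~ r + f *~ s.
Proof.
rewrite /mx_block; move: h ha hb ah bh hh => g ga gb ag bg gg.
rewrite !mulrDr !mulrzAr !mulrA fb -!(mulrA b a) ag aa.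
by rewrite !mulr0 mul0r !mul0rz !add0r.
Qed.

Let mx_block_row1 p q r s : e * mx_block p q r s = e *~ p + a *~ q.
Proof.
rewrite /mx_block; move: h ha hb ah bh hh => g ga gb ag bg gg.
rewrite !mulrDr !mulrzAr !mulrA ea -!(mulrA a b) bg bb.
by rewrite !mulr0 mul0r !mul0rz add0r !addr0.
Qed.

Lemma mx_block_compl p q r s : h * mx_block p q r s = h.
Proof.
rewrite /mx_block; move: h ha hb ah bh hh => g ga gb ag bg gg.
by rewrite !mulrDr !mulrzAr !mulrA ga gb !mul0r !mul0rz !addr0.
Qed.
Let mx_block_compr p q r s : mx_block p q r s * h = h.
Proof.
rewrite /mx_block; move: h ha hb ah bh hh => g ga gb ag bg gg.
by rewrite !mulrDl !mulrzAl -!mulrA ag bg !mulr0 !mul0rz !addr0.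
Qed.

Let tM : mx_block 0 (-1) 1 (-1) * mx_block (-1) 1 (-1) 0 = 1.
Proof. by rewrite mx_blockM -mx_block1. Qed.
Let ss : mx_block 0 1 1 0 * mx_block 0 1 1 0 = 1.
Proof. by rewrite mx_blockM -mx_block1. Qed.
Let ut : {unit R} := FinRing.unit R (unitr_mul1 tM).
Let us : {unit R} := FinRing.unit R (unitr_mul1 ss).

Let a_neq0 : a != 0. Proof. by case/and5P: ab_mx. Qed.

Let ut_neq1 : ut != 1%g.
Proof.
apply: contra_neq a_neq0 => /(congr1 val)/(congr1 ( *%R e))/=.
rewrite mx_block_row1 mulr1 mulr0z add0r => /(congr1 ( *%R^~ a)).
by rewrite ea mulrzAl aa mul0rz.
Qed.

Let us_neq1 : us != 1%g.
Proof.
apply: contra_neq a_neq0 => /(congr1 val)/(congr1 ( *%R e))/=.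
rewrite mx_block_row1 mulr1 mulr0z add0r => /(congr1 ( *%R^~ a)).
by rewrite ea mulrzAl aa mul0rz.
Qed.

Let ut3 : (ut ^+ 3 = 1)%g.
Proof. by apply: val_inj; rewrite /= mulrA !mx_blockM -mx_block1. Qed.
Let us2 : (us ^+ 2 = 1)%g.
Proof. by apply: val_inj; rewrite /= ss. Qed.
Let utJ : (ut ^ us = ut ^+ 2)%g.
Proof.
apply: (mulgI us); rewrite conjgE !mulgA mulgV mul1g.
by apply: val_inj; rewrite /= !mx_blockM.
Qed.

Hypothesis mnnR : min_nonnilpotent [set: {unit R}]%G.

(* [ut] and [us] generate a copy of S_3, which is not nilpotent. *)
Let units_ut_us : (<[ut]> * <[us]> = [set: {unit R}])%g.
Proof.
have nut : (<[us]> \subset 'N(<[ut]>))%g by rewrite norms_cycle utJ mem_cycle.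
rewrite -norm_joinEr //; apply/eqP; rewrite -[_ == _]negbK; apply/negP=> neqG.
have [_ nilG] := mnnR; have := nilG (<[ut]> <*> <[us]>)%G.
rewrite properEneq neqG subsetT => /(_ isT) nilH.
have ot : #[ut]%g = 3 by apply: nt_prime_order.
have os : #[us]%g = 2 by apply: nt_prime_order.
have cent : (<[us]> \subset 'C(<[ut]>))%g.
  apply: (sub_nilpotent_cent2 nilH); rewrite ?joing_subl ?joing_subr //.
  by rewrite -!orderE ot os.
case/eqP: ut_neq1; apply: (mulgI ut); rewrite mulg1.
move: cent; rewrite cycle_subG => /centP/(_ ut (cycle_id ut)) cent.
by rewrite -[LHS]/(ut ^+ 2)%g -utJ conjgE -cent mulKg.
Qed.

(** These are the six products of a power of [ut] and a power of [us]. In the last case only the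
    lower left entry matters, as it rules out that the second row is [f]. *)
Lemma unit_mx_block (u : {unit R}) :
  [\/ val u = 1, val u = mx_block 1 (-1) 0 (-1) |
    exists p q r s, val u = mx_block p q r s /\ (r = 1 \/ r = -1)].
Proof.
have : u \in [set: {unit R}] by rewrite inE.
rewrite -units_ut_us => /mulsgP[_ _ /cycleP[i ->] /cycleP[j ->] ->].
rewrite -(expg_mod i ut3) -(expg_mod j us2) /=.
have := ltn_pmod i (isT : (0 < 3)%N); have := ltn_pmod j (isT : (0 < 2)%N).
case: (i %% 3)%N => [|[|[|//]]]; case: (j %% 2)%N => [|[|//]] _ _;
  rewrite ?expg0 ?expg1 ?mulg1 ?mul1g /= ?mulr1 ?mul1r ?mulr1 ?mx_blockM.
- exact: Or31.
- by apply: Or33; do 4!eexists; split; [reflexivity|left].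
- by apply: Or33; do 4!eexists; split; [reflexivity|left].
- by apply: Or33; do 4!eexists; split; [reflexivity|right].
- by apply: Or33; do 4!eexists; split; [reflexivity|right].
- exact: Or32.
Qed.

Let hu (u : {unit R}) : h * val u = h.
Proof.
by case: (unit_mx_block u) => [->|->|[p [q [r [s [-> _]]]]]];
  rewrite ?mulr1 ?mx_block_compl.
Qed.

Lemma unit_mx_compl (u : {unit R}) : val u * h = h.
Proof.
by case: (unit_mx_block u) => [->|->|[p [q [r [s [-> _]]]]]];
  rewrite ?mul1r ?mx_block_compr.
Qed.

Let sqr0_compl x : x * x = 0 -> h * x = 0 /\ x * h = 0.
Proof.
move=> xx; have U : 1 + x \is a GRing.unit by apply: (@nil_unit1D _ _ 2).
have := hu (FinRing.unit R U); have := unit_mx_compl (FinRing.unit R U).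
rewrite /= [h * _]mulrDr mulrDl mul1r mulr1 => /(canRL (addKr _))->
  /(canRL (addKr _))->.
by rewrite addNr.
Qed.

(** The off-diagonal components of [x] with respect to [h] square to zero, and [sqr0_compl] kills
    them. *)
Lemma mx_compl_central x : h * x = x * h.
Proof.
have d'h : (1 - h) * h = 0 by rewrite mulrBl mul1r hh subrr.
have hd' : h * (1 - h) = 0 by rewrite mulrBr mulr1 hh subrr.
have /sqr0_compl[/eqP + _] : h * x * (1 - h) * (h * x * (1 - h)) = 0.
  by rewrite !mulrA -(mulrA _ (1 - h) h) d'h mulr0 !mul0r.
have /sqr0_compl[_ /eqP +] : (1 - h) * x * h * ((1 - h) * x * h) = 0.
  by rewrite !mulrA -(mulrA _ h (1 - h)) hd' mulr0 !mul0r.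
rewrite !mulrA hh -(mulrA _ h h) hh mulrBl mul1r mulrBl mulrBr mulr1 !subr_eq0.
by move=> /eqP-> /eqP.
Qed.

(** Here [x] squares to zero, and the second row of the unit [1 + x] is [f]; this leaves two of the
    six units. *)
Let upper_unit x : e * x * f = x -> x = 0 \/ f + f = 0 /\ x = - a.
Proof.
move=> Dx; have fe : f * e = 0 by rewrite mulrA -(mulrA b a a) aa mulr0 mul0r.
have ex : e * x = x by rewrite -Dx !mulrA ea.
have fx : f * x = 0 by rewrite -ex mulrA fe mul0r.
have xx : x * x = 0 by rewrite -{1}Dx -mulrA fx mulr0.
have U : 1 + x \is a GRing.unit by apply: (@nil_unit1D _ _ 2).
case: (unit_mx_block (FinRing.unit R U)) => /= [x1|x1|[p [q [r [s [x1 r1]]]]]].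
- by left; apply: (addrI 1); rewrite x1 addr0.
- right; split.
    have := congr1 ( *%R f) x1; rewrite mulrDr mulr1 fx addr0 mx_block_row2.
    by rewrite mulr0z add0r => Df; rewrite {1}Df mulrN1z addNr.
  have := congr1 ( *%R e) x1; rewrite mulrDr mulr1 ex mx_block_row1.
  by rewrite mulr1z mulrN1z => /addrI.
- case/eqP: b_neq0; rewrite -fb; have := congr1 ( *%R f) x1.
  rewrite mulrDr mulr1 fx addr0 mx_block_row2 => /(congr1 ( *%R^~ a)).
  rewrite mulrDl !mulrzAl -!mulrA aa mulr0 mul0rz addr0.
  by case: r1 => -> /eqP; rewrite ?mulr1z ?mulrN1z eq_sym ?oppr_eq0 => /eqP f0;
    rewrite mulrA f0 mul0r.
Qed.

(** The nonzero element [a] of $eRf$ gives $2f = 0$, matrix units carry this to [e], and the unit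
    $-1$, trivial on [h], gives $2h = 0$. *)
Lemma mx_char2 : 1 + 1 = 0 :> R.
Proof.
have eaf : e * a * f = a by rewrite ea mulrA ea.
have [a0|[f2 _]] := upper_unit eaf; first by case/eqP: (a_neq0).
have b2 : b + b = 0 by rewrite -fb -mulrDl f2 mul0r.
have e2 : e + e = 0 by rewrite -mulrDr b2 mulr0.
have U : (-1 : R) \is a GRing.unit by apply: (@unitr_mul1 _ _ (-1));
  rewrite mulrNN mulr1.
have h2 : h + h = 0 by rewrite -{1}(unit_mx_compl (FinRing.unit R U))
  /= mulN1r addNr.
have D1 : 1 = h + (e + f) by rewrite mx_complE subrK.
by rewrite D1 addrACA h2 add0r addrACA e2 f2 addr0.
Qed.

(** Right multiplication by [a] carries $eRe$ into $eRf$, which [upper_unit] describes, and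
    multiplication by [b] carries it back. *)
Lemma mx_corner x : e * x * e = 0 \/ e * x * e = e.
Proof.
have Dy : e * (e * x * a) * f = e * x * a.
  by rewrite !mulrA ea -!mulrA (mulrA a b a) ea.
have [y0|[_ Dy']] := upper_unit Dy.
  by left; rewrite mulrA y0 mul0r.
right; rewrite mulrA Dy'; apply/eqP; rewrite mulNr eqr_oppLR -addr_eq0.
by have := congr1 ( *%R e) mx_char2; rewrite mulrDr mulr1 mulr0 => ->.
Qed.

(** * Matrix entries over the field of two elements *)

Let nonzero_bit (s : R) : 'F_2 := (s != 0)%:R.
Let bitD w s s' : w != 0 -> s = 0 \/ s = w -> s' = 0 \/ s' = w ->
  nonzero_bit (s + s') = nonzero_bit s + nonzero_bit s'.
Proof.
move=> w0; have ww : w + w = 0.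
  by have := congr1 ( *%R w) mx_char2; rewrite mulrDr mulr1 mulr0.
rewrite /nonzero_bit => -[->|->] [->|->];
  rewrite ?addr0 ?add0r ?ww ?eqxx ?w0 //=; exact/val_inj.
Qed.

Let ee : e * e = e. Proof. by rewrite mulrA ea. Qed.

(** Matrix units of the first row and the first column: [rowv i * x * colv j] is the $(i, j)$ entry
    of [x], read in $eRe$. *)
Let rowv (i : 'I_2) : R := if i == 0 then e else a.
Let colv (j : 'I_2) : R := if j == 0 then e else b.
Let e_row i : e * rowv i = rowv i.
Proof. by rewrite /rowv; case: ifP. Qed.
Let col_e j : colv j * e = colv j.
Proof. by rewrite /colv; case: ifP; rewrite // mulrA fb. Qed.
Let row_col i j : rowv i * colv j = if i == j then e else 0.
Proof.
case: i => -[|[|//]] ?; case: j => -[|[|//]] ?; rewrite /rowv /colv /=;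
  do ?case: eqP => //=.
all: rewrite ?ee // -?mulrA ?bb ?mulr0 // ?mulrA ?aa ?mul0r //.
Qed.
Let sum_col_row : \sum_j colv j * rowv j = 1 - h.
Proof. by rewrite big_ord_recl big_ord1 /= mx_complE subKr ee. Qed.
Let h_col j : h * colv j = 0.
Proof. by rewrite /colv; case: ifP; rewrite ?mulrA ?ha ?hb ?mul0r. Qed.

Let entry i j x : rowv i * x * colv j = 0 \/ rowv i * x * colv j = e.
Proof.
have := mx_corner (rowv i * x * colv j).
by rewrite !mulrA e_row -!mulrA col_e !mulrA.
Qed.

Let mxpart (x : R) : 'M['F_2]_2 :=
  \matrix_(i, j) nonzero_bit (rowv i * x * colv j).

Let mxpartD x y : mxpart (x + y) = mxpart x + mxpart y.
Proof.
by apply/matrixP=> i j; rewrite !mxE mulrDr mulrDl; apply: (bitD e_neq0);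
  apply: entry.
Qed.

Let bit0 : nonzero_bit 0 = 0.
Proof. by rewrite /nonzero_bit eqxx. Qed.
Let bite : nonzero_bit e = 1.
Proof. by rewrite /nonzero_bit e_neq0. Qed.

Let bit_sum (I : finType) (F : I -> R) : (forall i, F i = 0 \/ F i = e) ->
  nonzero_bit (\sum_i F i) = \sum_i nonzero_bit (F i).
Proof.
move=> Fe; suff [] : (\sum_i F i = 0 \/ \sum_i F i = e) /\
    nonzero_bit (\sum_i F i) = \sum_i nonzero_bit (F i) by [].
elim/big_ind2: _ => [|x u y v [xe <-] [ye <-]|i _]; last by split.
  by split; [left | rewrite bit0].
split; last exact: (bitD e_neq0).
have e2 : e + e = 0 by have := congr1 ( *%R e) mx_char2;
  rewrite mulrDr mulr1 mulr0.
by case: xe ye => [->|->] [->|->]; rewrite ?addr0 ?add0r ?e2; auto.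
Qed.

Let mxpartM x y : mxpart (x * y) = mxpart x *m mxpart y.
Proof.
apply/matrixP=> i j; rewrite !mxE.
have -> : rowv i * (x * y) * colv j =
    \sum_k (rowv i * x * colv k) * (rowv k * y * colv j).
  under eq_bigr => k _ do rewrite !mulrA -(mulrA _ (colv k)).
  (* The sum inserts [1 - h] between [x] and [y]; the term in [h] vanishes because [h] is central
     and kills [colv j]. *)
  rewrite -!mulr_suml -mulr_sumr sum_col_row mulrBr mulr1 !mulrBl mulrA.
  by rewrite -[X in _ - X]mulrA -[X in _ - X]mulrA [h * _]mulrA
    mx_compl_central -!mulrA h_col !mulr0 subr0.
have mul_entry s s' : s = 0 \/ s = e -> s' = 0 \/ s' = e ->
    nonzero_bit (s * s') = nonzero_bit s * nonzero_bit s'.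
  by case=> -> [->|->]; rewrite ?mul0r ?mulr0 ?ee ?bit0 ?bite
    ?mul0r ?mulr0 ?mulr1.
rewrite bit_sum => [|k]; last first.
  by have [->|->] := entry i k x; have [->|->] := entry k j y;
    rewrite ?mul0r ?mulr0 ?ee; auto.
by apply: eq_bigr => k _; rewrite !mxE mul_entry.
Qed.

Let mxpart1 : mxpart 1 = 1.
Proof.
apply/matrixP=> i j; rewrite !mxE mulr1 row_col.
by case: eqP; rewrite (bit0, bite).
Qed.

(** * The Boolean complement and the isomorphism *)

Let compl_bool x : h * x = x -> x * x = x.
Proof.
move=> hx; have xh : x * h = x by rewrite -mx_compl_central.
have nil0 y n : h * y = y -> y ^+ n = 0 -> y = 0.
  move=> hy /nil_unit1D Uy; have := unit_mx_compl (FinRing.unit R Uy).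
  by rewrite /= mulrDl mul1r -mx_compl_central hy => /(canRL (addKr _))->;
    rewrite addNr.
have [n idem] := expr_idem_ex x; set g := x ^+ n.+1 in idem.
have xg : x * g = g * x by rewrite -exprS -exprSr.
have hg : h * g = g by rewrite /g exprS mulrA hx.
have Dxg : x * g = g.
  have [d Dd] : exists d, d = 1 - g by exists (1 - g).
  have gd : g * d = 0 by rewrite Dd mulrBr mulr1 idem subrr.
  have dg : d * g = 0 by rewrite Dd mulrBl mul1r idem subrr.
  have dd : d * d = d by rewrite {1}Dd mulrBl mul1r gd subr0.
  have hd : h * d = h - g by rewrite Dd mulrBr mulr1 hg.
  (* This unit is trivial on [h], which forces [x * g = g]. *)
  have U : x * g + d \is a GRing.unit.
    apply: (@unitr_mul1 _ _ (g * x ^+ n + d)).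
    rewrite mulrDl !mulrDr -(mulrA x g d) gd mulr0 addr0 [d * (g * _)]mulrA dg
      mul0r add0r dd.
    by rewrite mulrA -(mulrA x) idem xg -mulrA -exprS idem Dd addrC subrK.
  have := unit_mx_compl (FinRing.unit R U); rewrite /= -mx_compl_central.
  by rewrite mulrDr hd mulrA hx addrCA -[RHS]addr0 => /addrI/eqP;
    rewrite subr_eq0 => /eqP.
suff Dx : x = g by rewrite Dx.
(* The difference $x(1 - g)$ is nilpotent because $x^{n+1} = g$, and $hR$ has no nonzero
   nilpotents. *)
apply/eqP; rewrite -subr_eq0; apply/eqP/(nil0 _ n.+1);
  first by rewrite mulrBr hx hg.
have -> : x - g = x * (1 - g) by rewrite mulrBr mulr1 Dxg.
have xg' : GRing.comm x (1 - g) by rewrite /GRing.comm mulrBr mulrBl mulr1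
  mul1r xg.
rewrite exprMn_comm // [(1 - g) ^+ _]exprS mulrA -/g.
by rewrite mulrBr mulr1 idem subrr mul0r.
Qed.

(** After replacing [y] by $z = hy$, expand $(x + z)^2 = x + z$ in characteristic 2. *)
Let compl_comm x y : h * x = x -> y * x = x * y.
Proof.
move=> hx; have xh : x * h = x by rewrite -mx_compl_central.
have hyE : h * (h * y) = h * y by rewrite mulrA hh.
have -> : y * x = h * y * x by rewrite mx_compl_central -mulrA hx.
have -> : x * y = x * (h * y) by rewrite mulrA xh.
move: (h * y) hyE => z hz.
have := @compl_bool (x + z); rewrite mulrDr hx hz => /(_ erefl).
have char2 (w : R) : w + w = 0 by have := congr1 ( *%R w) mx_char2;
  rewrite mulrDr mulr1 mulr0.
rewrite mulrDl !mulrDr !compl_bool // -addrA => /addrI.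
rewrite addrA -[RHS]add0r => /addIr /(canRL (addKr _)) ->; rewrite addr0.
by apply/eqP; rewrite eq_sym -addr_eq0 char2.
Qed.

Let atoms : {set R} := [set x | [&& h * x == x, x != 0 &
  [forall y, (x * y == 0) || (x * y == x)]]].

Let atomP x : reflect [/\ h * x = x, x != 0 & forall y, x * y = 0 \/ x * y = x]
  (x \in atoms).
Proof.
rewrite inE; apply: (iffP and3P) => [[/eqP hx x0 /forallP H]|[/eqP hx x0 H]].
  by split=> // y; case/orP: (H y) => /eqP; auto.
by split=> //; apply/forallP=> y; case: (H y) => ->; rewrite eqxx ?orbT.
Qed.

Let atom_mul x y : x \in atoms -> y \in atoms ->
  x * y = if x == y then x else 0.
Proof.
move=> /atomP[hx x0 minx] /atomP[hy y0 miny]; case: eqP => [->|neq];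
  first exact: compl_bool.
have yx := @compl_comm x y hx.
case: (minx y) => // xy; case: (miny x) => yx'; first by rewrite -yx.
by case: neq; rewrite -xy -yx.
Qed.

Let atom_below x : h * x = x -> x != 0 -> exists2 g, g \in atoms & g * x = g.
Proof.
move=> hx x0; pose B : {pred R} := [pred y | h * y == y].
have BP y : reflect (h * y = y) (y \in B) by apply: eqP.
have [] := @idem_atom_ex R B x.
- by move=> y z /BP hy _; apply/BP; rewrite mulrA hy.
- by move=> y /BP; apply: compl_bool.
- by move=> y z _ /BP hz; apply: compl_comm.
- exact/BP.
- by [].
move=> g [/BP hg g0 xg ming]; exists g; last by rewrite compl_comm.
apply/atomP; split=> // y; have gh : g * h = g by rewrite -mx_compl_central.
by rewrite -[in X in X \/ _]gh -[in X in _ \/ X = _]gh -!mulrA; apply/ming/BP;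
  rewrite mulrA hh.
Qed.

Let k := #|atoms|.
Let atom (i : 'I_k) : R := enum_val i.
Let atom_in i : atom i \in atoms. Proof. exact: enum_valP. Qed.

Let boolpart (x : R) : {ffun 'I_k -> 'F_2} :=
  [ffun i => nonzero_bit (atom i * x)].

Let boolpartD x y : boolpart (x + y) = boolpart x + boolpart y.
Proof.
apply/ffunP=> i; rewrite !ffunE mulrDr; have /atomP[_ g0 ming] := atom_in i.
exact: (bitD g0).
Qed.

Let boolpartM x y : boolpart (x * y) = boolpart x * boolpart y.
Proof.
apply/ffunP=> i; rewrite !ffunE mulrA; have /atomP[_ g0 ming] := atom_in i.
case: (ming x) => ->; first by rewrite mul0r bit0 mul0r.
by rewrite {2}/nonzero_bit g0 mul1r.
Qed.

Let boolpart1 : boolpart 1 = 1.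
Proof.
apply/ffunP=> i; rewrite !ffunE mulr1; have /atomP[_ g0 _] := atom_in i.
by rewrite /nonzero_bit g0.
Qed.

Let parts x : 'M['F_2]_2 * {ffun 'I_k -> 'F_2} := (mxpart x, boolpart x).
Let unparts (u : 'M['F_2]_2 * {ffun 'I_k -> 'F_2}) : R :=
  \sum_i \sum_j (colv i * rowv j) *+ u.1 i j + \sum_i atom i *+ u.2 i.

Let bit_eq0 s : nonzero_bit s = 0 -> s = 0.
Proof. by rewrite /nonzero_bit; have [->|_] := eqVneq s 0. Qed.

(** An atom below a nonzero $hx$ would give a nonzero coordinate, so $hx = 0$; then [x] is a sum of
    products of its entries with matrix units. *)
Let parts_inj x : mxpart x = 0 -> boolpart x = 0 -> x = 0.
Proof.
move=> mx0 bx0.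
have hx0 : h * x = 0.
  apply/eqP; apply: contraT => hx_neq0.
  have [|g g_at gx] := atom_below _ hx_neq0; first by rewrite mulrA hh.
  have /atomP[hg g0 _] := g_at; case/eqP: g0.
  have gh : g * h = g by rewrite -mx_compl_central.
  have := congr1 (fun F : {ffun 'I_k -> 'F_2} => F (enum_rank_in g_at g)) bx0.
  rewrite !ffunE /atom enum_rankK_in // => /bit_eq0;
    rewrite -{1}gh -mulrA gx => //.
have -> : x = (1 - h) * x * (1 - h).
  by rewrite mulrBl mul1r hx0 subr0 mulrBr mulr1 -mx_compl_central hx0 subr0.
rewrite -sum_col_row !mulr_suml big1 // => i _.
rewrite mulr_sumr big1 // => j _.
have /bit_eq0 ij0 : nonzero_bit (rowv i * x * colv j) = 0.
  by have /matrixP/(_ i j) := mx0; rewrite !mxE.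
have -> : colv i * rowv i * x * (colv j * rowv j) =
    colv i * (rowv i * x * colv j) * rowv j by rewrite !mulrA.
by rewrite ij0 mulr0 mul0r.
Qed.

Let mxpart0 : mxpart 0 = 0.
Proof. by apply/matrixP=> i j; rewrite !mxE mulr0 mul0r bit0. Qed.
Let boolpart0 : boolpart 0 = 0.
Proof. by apply/ffunP=> i; rewrite !ffunE mulr0 bit0. Qed.
Let char2 (x : R) : x + x = 0.
Proof. by have := congr1 ( *%R x) mx_char2; rewrite mulrDr mulr1 mulr0. Qed.

Let unpartsK u : parts (unparts u) = u.
Proof.
case: u => M F; rewrite /parts /unparts /=.
have gcol i j : atom i * colv j = 0.
  by have /atomP[hg _ _] := atom_in i; rewrite -hg mx_compl_central -mulrA
    h_col mulr0.
have rowg i j : rowv i * atom j = 0.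
  have /atomP[hg _ _] := atom_in j; rewrite -hg mulrA -mx_compl_central.
  by rewrite /rowv; case: ifP; rewrite ?mulrA ?ha !mul0r.
have bit_nat w (x : 'F_2) : w != 0 -> nonzero_bit (w *+ x) = x.
  move=> w0; case: x => -[|[|//]] ?; rewrite
    /nonzero_bit ?mulr0n ?eqxx ?mulr1n ?w0; exact: val_inj.
congr (_, _).
  apply/matrixP=> i j; rewrite !mxE.
  have -> : rowv i * (\sum_k \sum_l (colv k * rowv l) *+ M k l +
      \sum_l atom l *+ F l) * colv j = e *+ M i j.
    rewrite mulrDr [X in _ + X]mulr_sumr [X in _ + X]big1 ?addr0 => [|l _];
      last first.
      by rewrite mulrnAr rowg mul0rn.
    rewrite mulr_sumr (bigD1 i) //= [X in _ + X]big1 ?addr0 => [|l neq];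
      last first.
      rewrite mulr_sumr big1 // => l' _.
      by rewrite mulrnAr mulrA row_col eq_sym (negPf neq) mul0r mul0rn.
    rewrite mulr_sumr mulr_suml (bigD1 j) //= [X in _ + X]
      big1 ?addr0 => [|l neq]; last first.
      by rewrite mulrnAr mulrnAl -!mulrA row_col (negPf neq) !mulr0 mul0rn.
    by rewrite mulrnAr mulrnAl mulrA row_col eqxx -mulrA row_col eqxx ee.
  exact: bit_nat.
apply/ffunP=> i; rewrite !ffunE.
have /atomP[_ g0 _] := atom_in i; rewrite -[RHS](bit_nat (atom i)) //.
congr (nonzero_bit _); rewrite mulrDr mulr_sumr big1 ?add0r => [|l _];
  last first.
  by rewrite mulr_sumr big1 // => l' _; rewrite mulrnAr mulrA gcol mul0r mul0rn.
rewrite mulr_sumr (bigD1 i) //= [X in _ + X]big1 ?addr0 => [|l neq]; last first.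
  rewrite mulrnAr atom_mul ?atom_in // (inj_eq enum_val_inj) eq_sym (negPf neq).
  by rewrite mul0rn.
by rewrite mulrnAr atom_mul ?atom_in // eqxx.
Qed.

Let partsK x : unparts (parts x) = x.
Proof.
have parts_diff y z : parts y = parts z -> y = z.
  case=> myz byz; have oppz : - z = z by apply/eqP;
    rewrite eqr_oppLR -addr_eq0 char2.
  apply/eqP; rewrite -subr_eq0 oppz; apply/eqP.
  apply: parts_inj; first by rewrite mxpartD myz -mxpartD char2 mxpart0.
  by rewrite boolpartD byz -boolpartD char2 boolpart0.
by apply: parts_diff; rewrite unpartsK.
Qed.

Lemma ring_isom_matrix_units :
  ring_isom R 'M['F_2]_2 \/
  exists k : nat, ring_isom R ('M['F_2]_2 * {ffun 'I_k.+1 -> 'F_2})%type.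
Proof.
(* The number of atoms is generalized to allow a case split: with no atoms the second factor is
   trivial and the matrix ring alone remains. *)
have : exists n (B : R -> {ffun 'I_n -> 'F_2}) inv, [/\
    forall x y, B (x + y) = B x + B y, forall x y, B (x * y) = B x * B y,
      B 1 = 1,
    forall u, (mxpart (inv u), B (inv u)) = u
    & forall x, inv (mxpart x, B x) = x].
  by exists k, boolpart, unparts.
case=> -[|n] [B [inv [BD BM B1 invK Kinv]]].
  left; apply: (@ring_isomI _ _ mxpart) => //.
  exists (fun M => inv (M, [ffun=> 0])) => [x|M].
    rewrite -[RHS]Kinv; congr (inv (_, _)); apply/ffunP; by case.
  exact: (congr1 fst (invK (M, [ffun=> 0]))).
right; exists n.
apply: (@ring_isomI _ ('M['F_2]_2 * {ffun 'I_n.+1 -> 'F_2})%type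
          (fun x => (mxpart x, B x))).
- by move=> x y; rewrite mxpartD BD.
- by move=> x y; rewrite mxpartM BM.
- by rewrite mxpart1 B1.
- by exists inv => [x|u]; [apply: Kinv | apply: invK].
Qed.

End MatrixUnits.

(** * Rings reduced modulo their radical *)

Lemma expr1D_prime (S : pzRingType) (x : S) p :
  prime p -> x *+ p = 0 -> (1 + x) ^+ p = 1 + x ^+ p.
Proof.
case: p => [|p] // pr_p px0; rewrite exprDn_comm; last exact/commr_sym/commr1.
rewrite big_ord_recl big_ord_recr /= bin0 binn !mulr1n expr0 mulr1 expr1n.
rewrite subnn expr0 mul1r big1 ?add0r // => i _.
have /dvdnP[m ->] : (p.+1 %| 'C(p.+1, bump 0 i))%N.
  by apply: prime_dvd_bin; rewrite // ltnS ltn_ord.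
by rewrite expr1n mul1r mulnC mulrnA exprS -mulrnAl px0 !mul0r mul0rn.
Qed.

Lemma mulrn_mod (V : zmodType) (x : V) n d : x *+ d = 0 ->
  x *+ (n %% d) = x *+ n.
Proof.
by move=> xd0; rewrite {2}(divn_eq n d) mulrnDr mulnC mulrnA xd0 mul0rn add0r.
Qed.

Section ReducedModJac.
Variable R : finUnitRingType.
Hypothesis mnnR : min_nonnilpotent [set: {unit R}]%G.
Hypothesis redR : forall x : R, x * x \in Jac R -> x \in Jac R.
Local Notation K := ('ker (@unitJ_morphism R))%g.
Local Notation G := [set: {unit R}].
Implicit Types x y z : R.

Lemma Jac_quot_reduced (z : Jac_quot R) : z * z = 0 -> z = 0.
Proof.
have [x <-] := piJ_repr z; rewrite -rmorphM => /eqP; rewrite piJ_eq0 => /redR.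
by rewrite -piJ_eq0 => /eqP.
Qed.

Lemma nil_Jac x n : x ^+ n.+1 = 0 -> x \in Jac R.
Proof.
move=> xn0; rewrite -piJ_eq0; apply/eqP.
apply: (reduced_expr Jac_quot_reduced (n := n)).
by rewrite -rmorphXn xn0 rmorph0.
Qed.

Lemma abelian_Jac_units : abelian (unitJ_morphism R @* G)%g.
Proof.
apply/centsP=> u _ v _; apply: val_inj.
exact: reduced_comm Jac_quot_reduced _ _.
Qed.

(** Two uses are covered: [c = 1] when $|R|$ is a power of 2, and the idempotent of [primary_idem]
    for an odd prime. *)
Variables (p k : nat) (c : R).
Hypotheses (pr_p : prime p) (cc : c * c = c) (centc : forall x, c * x = x * c).
Hypothesis pc : c *+ (p ^ k) = 0.
Hypothesis trivial_units : forall u : {unit R}, val u * (1 - c) = 1 - c.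

Lemma Jac_sub_corner x : x \in Jac R -> c * x = x.
Proof.
move=> Jx; have [n xn0] := Jac_nil Jx.
have := trivial_units (FinRing.unit R (nil_unit1D xn0)).
rewrite /= mulrDl mul1r -[RHS]addr0 => /addrI/eqP.
by rewrite mulrBr mulr1 subr_eq0 -centc => /eqP.
Qed.

Lemma corner_torsion x : c * x = x -> x *+ (p ^ k) = 0.
Proof. by move=> <-; rewrite -mulrnAl pc mul0r. Qed.

Lemma Jac_group_set : group_set [set x | x \in Jac R].
Proof.
apply/group_setP; split=> [|x y]; rewrite !in_set; first exact: rpred0.
by move=> Jx Jy; apply: rpredD.
Qed.

(** Subtracting 1 maps the kernel bijectively onto the radical, whose additive group is killed by
    $p^k$. *)
Lemma ker_unitJ_pgroup : (p.-group K)%g.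
Proof.
have cardK : #|K| = #|Group Jac_group_set|.
  rewrite -(card_imset (f := fun u : {unit R} => val u - 1) K); last first.
    by move=> u v /addIr/val_inj.
  apply: eq_card => x; rewrite in_set; apply/imsetP/idP => [[u Ku ->]|Jx].
    by rewrite -ker_unitJ.
  have [n xn0] := Jac_nil Jx; exists (FinRing.unit R (nil_unit1D xn0)).
    by rewrite ker_unitJ /= addrC addKr.
  by rewrite /= addrC addKr.
rewrite /pgroup cardK; apply/pgroupP=> q pr_q /Cauchy[] // x;
  rewrite in_set => Jx ox.
have : (q %| p ^ k)%N.
  by rewrite -ox order_dvdn FinRing.zmodXgE corner_torsion ?Jac_sub_corner.
by rewrite Euclid_dvdX // => /andP[]; rewrite dvdn_prime2.
Qed.

Lemma unit_sub1_corner (u : {unit R}) : c * (val u - 1) = val u - 1.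
Proof.
have : (val u - 1) * (1 - c) = 0 by rewrite mulrBl mul1r trivial_units subrr.
by rewrite mulrBr mulr1 centc => /subr0_eq.
Qed.

(** A unit of order p in $R/J$ is $1 + t$ with $pt = 0$, so $t^p = 0$ and $t = 0$ by reducedness. *)
Lemma p'group_Jac_units : (p^'.-group (unitJ_morphism R @* G))%g.
Proof.
rewrite im_unitJ; apply/pgroupP=> q pr_q q_dv; rewrite !inE; apply/eqP=> Dq.
rewrite {q}Dq in pr_q q_dv.
have [v _ ov] := Cauchy pr_p q_dv.
have [u Du] : exists u, unitJ u = v.
  have : v \in (unitJ_morphism R @* G)%g by rewrite im_unitJ inE.
  by case/morphimP=> u _ _ ->; exists u.
have pc0 : piJ c *+ p = 0.
  apply: (reduced_expr Jac_quot_reduced (n := k)).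
  have pck : piJ c *+ (p ^ k) = 0 by have := congr1 (@piJ R) pc;
    rewrite rmorphMn rmorph0.
  by rewrite exprMn_n expnSr mulrnA exprSr -mulrnAr pck mulr0 mul0rn.
pose t := piJ (val u - 1).
have tp : t *+ p = 0 by rewrite /t -unit_sub1_corner rmorphM -mulrnAl pc0 mul0r.
have Dv : val v = 1 + t by rewrite -Du /= /t rmorphB rmorph1 addrC subrK.
have : t ^+ p = 0.
  apply: (addrI 1); rewrite -expr1D_prime // -Dv addr0.
  by rewrite -FinRing.val_unitX -ov expg_order.
rewrite -[p]prednK ?prime_gt0 // => /(reduced_expr Jac_quot_reduced) t0.
have v1 : v = 1%g by apply: val_inj; rewrite Dv t0 addr0.
by move: (prime_gt1 pr_p); rewrite -ov v1 order1.
Qed.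

Lemma Jac_units_cyclic : exists q, prime q /\ exists g : {unit R},
  (unitJ_morphism R @* G = <[unitJ g]>)%g /\
  (q.-group (unitJ_morphism R @* G))%g.
Proof.
have [q [g [pr_q _ qg defG]]] :=
  mnn_cyclic_mod mnnR ker_unitJ_pgroup p'group_Jac_units abelian_Jac_units.
have Dim : (unitJ_morphism R @* G = <[unitJ g]>)%g.
  have := congr1 (fun A : {set {unit R}} => (unitJ_morphism R @* A)%g) defG.
  by rewrite /= morphimY ?subsetT // morphim_ker joingG1 /= morphim_cycle ?inE
    // => <-.
exists q; split=> //; exists g; split=> //.
by rewrite Dim -[unitJ g]/(unitJ_morphism R g) -morphim_cycle ?inE
  // morphim_pgroup.
Qed.

(** * Excluding odd primes *)

Hypotheses (odd_p : odd p) (c_neq0 : c != 0).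

Lemma corner_div4 x : c * x = x -> exists r, x = x *+ 4 *+ r.
Proof.
move=> cx; have co4 : coprime 4 (p ^ k)
  by rewrite coprimeXr // (@coprimeXl 2 2) // coprime2n.
have /dvdnP[r Dr] : (4 %| chinese 4 (p ^ k) 0 1)%N.
  by rewrite /dvdn (chinese_modl co4).
exists r; rewrite -mulrnA mulnC -Dr -(mulrn_mod _ (corner_torsion cx)).
by rewrite (chinese_modr co4) mulrn_mod ?mulr1n // corner_torsion.
Qed.

Lemma corner_double_Jac x : c * x = x -> x + x \in Jac R -> x \in Jac R.
Proof.
move=> cx J2x; have [r ->] := corner_div4 cx.
by rewrite (mulrnA x 2 2 : x *+ 4 = _) [x *+ 2]mulr2n; do 2!apply: rpredMn.
Qed.

Lemma reflection_unit (e : R) : e * e = e -> (1 - (e + e)) * (1 - (e + e)) = 1.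
Proof.
move=> ee; rewrite mulrBl mul1r -[RHS]addr0 -addrA; congr (_ + _).
by rewrite mulrBr mulr1 opprB mulrDl !mulrDr ee addrK addNr.
Qed.

Lemma reflection_order e (ee : e * e = e) : c * e = e -> e != 0 ->
  #[unitJ (FinRing.unit R (unitr_mul1 (reflection_unit ee)))]%g = 2.
Proof.
move=> ce e0; apply: nt_prime_order => //.
  by apply: val_inj; rewrite /= -rmorphM reflection_unit // rmorph1.
apply: contra_neq e0 => /eqP u1; apply: (Jac_idem _ ee).
apply: corner_double_Jac => //; move: u1.
have -> : (unitJ (FinRing.unit R (unitr_mul1 (reflection_unit ee))) == 1%g) =
    (FinRing.unit R (unitr_mul1 (reflection_unit ee)) \in K) by rewrite !inE.
by rewrite ker_unitJ /= addrAC subrr add0r rpredN.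
Qed.

(** A cyclic group has at most one involution, so the reflections in [e] and [c] agree modulo the
    radical; as 2 is invertible on $cR$, the idempotent [c - e] lies in the radical. *)
Lemma corner_idem_trivial e : e * e = e -> c * e = e -> e = 0 \/ e = c.
Proof.
move=> ee ce; have [->|e0] := eqVneq e 0; [by left | right].
have [_ [_ [g [Ug _]]]] := Jac_units_cyclic.
set G' := (unitJ_morphism R @* G)%g in Ug.
have oe := reflection_order ee ce e0; have oc := reflection_order cc cc c_neq0.
set u := unitJ _ in oe; set w := unitJ _ in oc.
have cycG : cyclic G' by rewrite Ug cycle_cyclic.
have inG v : v \in G' by rewrite /G' im_unitJ inE.
have : <[u]>%g == <[w]>%g.
  by rewrite (eq_subG_cyclic cycG) ?cycle_subG // -!orderE oe oc.
move/eqP/setP/(_ u); rewrite cycle_id cycle2g //.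
rewrite !inE => /esym/orP[/eqP u1|/eqP uw]; first by move: oe;
  rewrite u1 order1.
have Je : (c - e) + (c - e) \in Jac R.
  have := congr1 val uw; rewrite /u /w /= => /eqP;
    rewrite -subr_eq0 -rmorphB piJ_eq0.
  by rewrite opprB addrC addrA subrK opprD addrACA.
have ec : e * c = e by rewrite -centc.
have cee : c * (c - e) = c - e by rewrite mulrBr cc ce.
have idem : (c - e) * (c - e) = c - e by rewrite mulrBl cee mulrBr ec ee subrr
  subr0.
by have /(_ idem)/eqP := Jac_idem (corner_double_Jac cee Je);
  rewrite subr_eq0 eq_sym => /eqP.
Qed.

Let X := ('C_(G)(K) * K)%g.
(** An additive form of membership in [X]: for units the two agree ([D_X], [X_D]), but [D] is also
    closed under subtraction. *)
Let D x := exists2 j, j \in Jac R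
  & forall i, i \in Jac R -> (x - j) * i = i * (x - j).

Let DB x y : D x -> D y -> D (x - y).
Proof.
case=> j Jj jC [l Jl lC]; exists (j - l); first exact: rpredB.
have -> : x - y - (j - l) = (x - j) - (y - l) by rewrite !opprB addrACA
  [RHS]addrACA [- j - y]addrC.
by move=> i Ji; rewrite mulrBl mulrBr jC // lC.
Qed.

Let DMn x n : D x -> D (x *+ n).
Proof.
case=> j Jj jC; exists (j *+ n); first exact: rpredMn.
by move=> i Ji; rewrite -mulrnBl mulrnAl mulrnAr jC.
Qed.

Let D_central x : (forall y, x * y = y * x) -> D x.
Proof. by move=> xC; exists 0; rewrite ?rpred0 // => i _; rewrite subr0 xC. Qed.

Let D_Jac x : x \in Jac R -> D x.
Proof. by move=> Jx; exists x => // i _; rewrite subrr mul0r mulr0. Qed.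

Let D_X (u : {unit R}) : u \in X -> D (val u).
Proof.
case/mulsgP=> v w /setIP[_ /centP vC] Kw ->; move: Kw; rewrite ker_unitJ => Jw.
exists (val v * (val w - 1)); first exact: idealMr.
move=> i Ji; have -> : val (v * w)%g - val v * (val w - 1) = val v.
  by rewrite /= mulrBr mulr1 opprB addrC subrK.
have [n in0] := Jac_nil Ji.
have Kz : FinRing.unit R (nil_unit1D in0) \in K by rewrite ker_unitJ /= addrC
  addKr.
have /(congr1 val) := vC _ Kz; rewrite /= mulrDr mulrDl mulr1 mul1r.
exact: addrI.
Qed.

Let X_D (u : {unit R}) : D (val u) -> u \in X.
Proof.
case=> j Jj jC; have Uu := valP u.
have Uv : val u - j \is a GRing.unit.
  have j0 : piJ j = 0 by apply/eqP; rewrite piJ_eq0.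
  by rewrite -piJ_unit rmorphB /= j0 subr0 piJ_unit.
pose v := FinRing.unit R Uv.
apply/mulsgP; exists v (v^-1 * u)%g; rewrite ?mulKVg //.
  rewrite inE in_setT; apply/centP=> w; rewrite ker_unitJ => Jw.
  have commB1 (y z : R) : y * (z - 1) = (z - 1) * y -> y * z = z * y.
    by rewrite mulrBr mulrBl mulr1 mul1r => /addIr.
  by apply: val_inj; apply: commB1; apply: jC.
rewrite ker_unitJ /=.
have -> : (val u - j)^-1 * val u - 1 = (val u - j)^-1 * j.
  by apply: (mulrI Uv); rewrite mulrBr mulr1 !mulVKr // opprB addrC subrK.
exact: idealMr.
Qed.

(* The unit group modulo the radical is cyclic of even order, so a square *)
(* cannot generate it.                                                   *)
Let X_sqr (u : {unit R}) : (u * u)%g \in X.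
Proof.
apply: (mnn_mem_cent_ker mnnR ker_unitJ_pgroup p'group_Jac_units).
  by rewrite inE.
apply/eqP=> defG.
have Ug : (unitJ_morphism R @* G = <[unitJ u ^+ 2]>)%g.
  have := congr1 (fun A : {set {unit R}} => (unitJ_morphism R @* A)%g) defG.
  rewrite /= morphimY ?subsetT // morphim_ker joingG1 /= morphim_cycle ?inE
    // => <-.
  by rewrite /= unitJ_morph ?inE.
have dv_ord (v : {unit R}) : (#[unitJ v]%g %| #[unitJ u ^+ 2]%g)%N.
  by rewrite {2}/order -Ug; apply: order_dvdG; rewrite /= im_unitJ inE.
(* The reflection in [c] makes the order of the image of [u] even, so squaring halves it. *)
have := dv_ord (FinRing.unit R (unitr_mul1 (reflection_unit cc))).
rewrite reflection_order // => dv2.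
have := dv_ord u; have dvu := dvdn_trans dv2 (orderXdvd _ _).
rewrite orderXgcd (gcdn_idPr dvu) => /dvdn_leq.
rewrite divn_gt0 // dvdn_leq // => /(_ isT);
  rewrite leqNgt ltn_Pdiv ?order_gt0 //.
Qed.

(** If an idempotent power of [z] is 0, then [z] lies in the radical; if it is [c], then $z + (1 -
    c)$ is a unit and [X_sqr] applies. *)
Let D_sqr z : c * z = z -> D (z * z).
Proof.
move=> cz; have [n idem] := expr_idem_ex z.
have [|zn0|znc] := corner_idem_trivial idem; first by rewrite exprS mulrA cz.
  by apply: D_Jac; apply: idealMr; apply: nil_Jac zn0.
have [d Dd] : exists d, d = 1 - c by exists (1 - c).
have cd : c * d = 0 by rewrite Dd mulrBr mulr1 cc subrr.
have dd : d * d = d by rewrite {1}Dd mulrBl mul1r cd subr0.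
have centd x : d * x = x * d by rewrite Dd mulrBl mulrBr mul1r mulr1 centc.
have zd : z * d = 0 by rewrite -cz -centd mulrA centd cd mul0r.
have U : z + d \is a GRing.unit.
  apply: (@unitr_mul1 _ _ (c * z ^+ n + d)).
  rewrite mulrDl !mulrDr zd addr0 mulrA -centc cz -exprS znc mulrA centd cd
    mul0r add0r dd.
  by rewrite Dd addrC subrK.
have := D_X (X_sqr (FinRing.unit R U)); rewrite /= mulrDl !mulrDr zd centd zd
  dd addr0 add0r.
by move/DB/(_ (D_central centd)); rewrite addrK.
Qed.

(* Every square of [cR] lies in [D], hence so does [4y = (y+c)^2 - (y-c)^2],  *)
(* and [cR] has odd order; thus every unit lies in [X].                      *)
Lemma odd_reduced_absurd : False.
Proof.
have Dc y : c * y = y -> D y.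
  move=> cy; have [r ->] := corner_div4 cy; apply: DMn.
  have yc : y * c = y by rewrite -centc.
  have -> : y *+ 4 = (y + c) * (y + c) - (y - c) * (y - c).
    have -> : (y + c) * (y + c) = y * y + (y + y + c).
      by rewrite mulrDr !mulrDl yc cy cc !addrA.
    have -> : (y - c) * (y - c) = y * y + (c - (y + y)).
      by rewrite mulrBr !mulrBl yc cy cc opprB -addrA [- y + _]addrCA -opprD.
    rewrite opprD addrACA subrr add0r opprB addrACA subrr addr0.
    by rewrite (mulrnA y 2 2 : y *+ 4 = _) !mulr2n.
  by apply: DB; apply: D_sqr; rewrite (mulrBr, mulrDr) cy cc.
case/eqP: (mnn_cent_ker mnnR ker_unitJ_pgroup abelian_Jac_units).
apply/setP=> u; rewrite in_setT; apply: X_D.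
have -> : val u = c * val u - (c - 1).
  have := trivial_units u; rewrite mulrBr mulr1 -centc opprB => <-.
  by rewrite addrC subrK.
apply: DB; first by apply: Dc; rewrite mulrA cc.
by apply: D_central => y; rewrite mulrBl mulrBr mul1r mulr1 centc.
Qed.

End ReducedModJac.

(** * Conclusion *)

Lemma odd_prime_absurd (R : finUnitRingType) p :
  min_nonnilpotent [set: {unit R}]%G -> prime p -> odd p -> (p %| #|R|)%N ->
    False.
Proof.
move=> mnnR pr_p odd_p p_dv.
have odd_mulrn (x : R) n : x + x = 0 -> odd n -> x *+ n = 0 -> x = 0.
  move=> x2 odd_n; rewrite -(odd_double_half n) odd_n mulrS -muln2 mulnC mulrnA.
  by rewrite mulr2n x2 mul0rn addr0.
have [[a [b ab_mx]]|redR] := matrix_units_or_reduced R.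
  have [x x0 px0] := prime_torsion pr_p p_dv; case/eqP: x0.
  apply: odd_mulrn px0 => //.
  by have := congr1 ( *%R x) (mx_char2 ab_mx mnnR); rewrite mulrDr mulr1 mulr0.
have [c [k [cc c0 centc pc]]] := primary_idem pr_p p_dv.
have [cu|c'u] := central_idem_units mnnR cc centc.
  (* Were all units trivial on [c], the unit $-1$ would give $2c = 0$, against the odd torsion of
     [c]. *)
  case/eqP: c0; apply: odd_mulrn pc; last by rewrite oddX odd_p orbT.
  have UN1 : -1 * -1 = 1 :> R by rewrite mulrNN mulr1.
  by rewrite -{1}(cu (FinRing.unit R (unitr_mul1 UN1))) /= mulN1r addNr.
exact: (odd_reduced_absurd mnnR redR pr_p cc centc pc c'u odd_p c0).
Qed.

Theorem theorem1 (R : finUnitRingType) (a m : nat)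
    (cardR : #|R| = (2 ^ a * m)%N) (odd_m : odd m)
    (mnnR : min_nonnilpotent [set: {unit R}]%G) :
  #|R| = (2 ^ a)%N /\
  ((forall p : nat, prime p -> ~~ (p.-group [set: {unit (Jac_quot R)}])%g) ->
     ring_isom R 'M['F_2]_2 \/
     exists k : nat, ring_isom R ('M['F_2]_2 * {ffun 'I_k.+1 -> 'F_2})%type).
Proof.
have m1 : m = 1%N.
  apply/eqP; apply: contraT => m_neq1.
  have pr_p : prime (pdiv m).
    by apply: pdiv_prime; case: m odd_m m_neq1 {cardR} => [|[]].
  case: (@odd_prime_absurd R (pdiv m)) => //.
    exact: dvdn_odd (pdiv_dvd m) odd_m.
  by rewrite cardR dvdn_mull ?pdiv_dvd.
have card2 : #|R| = (2 ^ a)%N by rewrite cardR m1 muln1.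
split=> // not_pgroup.
have [[x [y xy_mx]]|redR] := matrix_units_or_reduced R.
  exact: ring_isom_matrix_units xy_mx mnnR.
(* With [c = 1] triviality of units on [1 - c] is vacuous, and $|R| = 2^a$ gives the torsion
   hypothesis. *)
have [] := @Jac_units_cyclic R mnnR redR 2 a 1.
- by [].
- by move=> x; rewrite mul1r mulr1.
- by rewrite -card2 natr_card.
- by move=> u; rewrite subrr mulr0.
move=> q [pr_q [_ [_]]]; rewrite im_unitJ => qU.
by case/negP: (not_pgroup q pr_q).
Qed.
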